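(* Let $h>0$ and assume $g$ satisfies (H). Fix $c>0$ and suppose $u_1(t,x)=\phi(\nu\cdot x+ct)$ and $u_2(t,x)=\psi(\nu\cdot x+ct)$ are two traveling fronts of equation (1) propagating at the same velocity $c$. Then there exists $s_0\in\mathbb{R}$ such that $\phi(s)=\psi(s+s_0)$ for all $s\in\mathbb{R}$.
   Context: Hypothesis (H): $g:\mathbb{R}_+\to\mathbb{R}_+$ is continuous and strictly increasing; $g(x)=x$ has exactly two nonnegative solutions $0$ and $\kappa>0$; $g$ is differentiable at $0,\kappa$ with $g'(0)>1$, $g'(\kappa)<1$; $g$ is $C^1$ near $\kappa$; and there exist $C>0$, $\theta\in(0,1]$, $\delta>0$ with $|g(u)/u-g'(0)|\le Cu^\theta$ for $u\in(0,\delta]$. Equation (1): $u_t(t,x)=\Delta u(t,x)-u(t,x)+g(u(t-h,x))$, $x\in\mathbb{R}^m$; $\nu\in\mathbb{R}^m$, $|\nu|=1$. A traveling front at velocity $c>0$ is a solution $u(t,x)=\phi(\nu\cdot x+ct)$ whose profile $\phi$ is $C^2$, positive, bounded, monotone, with $\phi(-\infty)=0$, $\phi(+\infty)=\kappa$, and satisfies $\phi''(s)-c\phi'(s)-\phi(s)+g(\phi(s-ch))=0$, $s\in\mathbb{R}$. *)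

(* Defs.v *)
From Stdlib Require Import Reals Lra.
Open Scope R_scope.

Definition right_deriv_at (g : R -> R) (x l : R) : Prop :=
  forall eps, 0 < eps -> exists d, 0 < d /\
    forall u, 0 < u < d -> Rabs ((g (x + u) - g x) / u - l) < eps.

(* Hypothesis (H) for g : R_+ -> R_+ (only values on [0,+oo) are constrained),
   with kappa the positive fixed point. *)
Definition HypH (g : R -> R) (kappa : R) : Prop :=
  (forall x, 0 <= x -> 0 <= g x) /\
  (forall x, 0 <= x -> forall eps, 0 < eps -> exists d, 0 < d /\
      forall y, 0 <= y -> Rabs (y - x) < d -> Rabs (g y - g x) < eps) /\
  (forall x y, 0 <= x -> x < y -> g x < g y) /\
  0 < kappa /\
  (forall x, 0 <= x -> (g x = x <-> (x = 0 \/ x = kappa))) /\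
  (* differentiable at 0 (one-sided, since 0 is the boundary of R_+),
     g'(0) > 1, and the Hoelder-type estimate near 0 *)
  (exists g0 : R, right_deriv_at g 0 g0 /\ 1 < g0 /\
     exists C theta delta, 0 < C /\ 0 < theta <= 1 /\ 0 < delta /\
       forall u, 0 < u <= delta -> Rabs (g u / u - g0) <= C * Rpower u theta) /\
  (exists gk : R, derivable_pt_lim g kappa gk /\ gk < 1) /\
  (exists eps, 0 < eps /\ exists dg : R -> R,
     forall x, Rabs (x - kappa) < eps ->
       derivable_pt_lim g x (dg x) /\ continuity_pt dg x).

Definition front_profile (g : R -> R) (kappa h c : R) (phi : R -> R) : Prop :=
  (exists d1 d2 : R -> R,
     (forall s, derivable_pt_lim phi s (d1 s)) /\
     (forall s, derivable_pt_lim d1 s (d2 s)) /\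
     (forall s, continuity_pt d2 s) /\
     (forall s, d2 s - c * d1 s - phi s + g (phi (s - c * h)) = 0)) /\
  (forall s, 0 < phi s) /\
  (exists M, forall s, Rabs (phi s) <= M) /\
  ((forall s t, s <= t -> phi s <= phi t) \/ (forall s t, s <= t -> phi t <= phi s)) /\
  (forall eps, 0 < eps -> exists A, forall s, s <= A -> Rabs (phi s) < eps) /\
  (forall eps, 0 < eps -> exists A, forall s, A <= s -> Rabs (phi s - kappa) < eps).

(* Main.v *)
Require Import Defs.
From Stdlib Require Import Reals Lra Lia Classical.
From Coquelicot Require Import Coquelicot.
Open Scope R_scope.

(* Write tau = c h, g0 = g'(0) and chi(l) = l^2 - c l - 1 + g0 e^{-l tau}. Uniqueness follows by
   sliding: if every shift psi(. + a) with a > a0 dominates phi near -oo, then it dominates phi on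
   the whole line, by the strong maximum principle and, near +oo, because g is a contraction
   near kappa. This needs the exact leading behaviour of profiles at -oo.

   If y = e^{-l s} phi tends to 0 and chi(l) <> 0, integrating the equation gives |int_{-oo}^s y| <= const * y(s) / |chi(l)|, hence a gain in the decay rate;
   so the optimal rate l is a root of chi. At this rate the flux
   y' + (2 l - c) y - B int_{s-tau}^s y, with B = g0 e^{-l tau}, converges exponentially fast.
   After subtracting a particular solution, p satisfies
   p' + m p + B int_{s-tau}^s (p(s) - p(x)) dx = O(e^{eps s}) with m = chi'(l), for which
   H = (B/2) int_{s-tau}^s (p(s) - p(x))^2 dx + m p(s)^2 / 2 is a Lyapunov function, satisfying
   |H(s)| <= C (H(s - 2 tau) - H(s)) + O(e^{2 eps s}). As p grows subexponentially, H decays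
   exponentially, hence so does p (or p', if m = 0), and phi ~ A e^{l s} or phi ~ - A s e^{l s} with A > 0, since otherwise phi
   would decay faster than the optimal rate. *)

(** Nothing in (H) selects the decay rate beforehand: g(u) <= g'(0) u is not imposed, and chi may
    have two positive roots, so at one speed c two profiles could a priori differ in rate or in
    prefactor (1 or -s). Sliding itself removes the ambiguity: the profile that is smaller near -oo
    would lie below every shift of the other one, and these shifts become arbitrarily small at each
    fixed point. Once rate and prefactor agree, only the coefficient A is left; shifting by a
    multiplies it by e^{l a}, and this determines s0.

    Pointwise control comes from the positive root mu of x^2 - c x - 1. Since g >= 0, it gives phi'
    <= mu phi, hence a Harnack inequality, which bounds the decay rate from above and turns integral
    bounds into pointwise ones. The Lyapunov function is suited to the equation for p because m may
    have either sign or vanish, and one argument then serves simple and double roots. Integrals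
    appear as differences of antiderivatives, integral inequalities as monotonicity of explicit
    functions. *)

Ltac derive :=
  auto_derive;
  [ repeat split; try (eexists; eauto; fail)
  | repeat match goal with
    | |- context [Derive ?f ?x] => erewrite (is_derive_unique f x) by eauto
    end ].

(** * Derivative tests, antiderivatives and limits at -oo *)

Lemma le_of_deriv_nonneg (f df : R -> R) (a b : R) :
  a <= b ->
  (forall x, a <= x <= b -> is_derive f x (df x)) ->
  (forall x, a <= x <= b -> 0 <= df x) -> f a <= f b.
Proof.
  intros Hab Hd Hp.
  destruct (MVT_gen f a b df) as [x [Hx He]].
  - intros x Hx. rewrite Rmin_left, Rmax_right in Hx by lra. apply Hd; lra.
  - intros x Hx. rewrite Rmin_left, Rmax_right in Hx by lra.
    apply continuity_pt_filterlim, (ex_derive_continuous f).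
    exists (df x). apply Hd; lra.
  - rewrite Rmin_left, Rmax_right in Hx by lra.
    assert (0 <= df x * (b - a)) by (apply Rmult_le_pos; [apply Hp|]; lra).
    lra.
Qed.

Lemma mvt_deriv (f df : R -> R) (a b : R) :
  a <= b ->
  (forall x, a <= x <= b -> is_derive f x (df x)) ->
  exists x, a <= x <= b /\ f b - f a = df x * (b - a).
Proof.
  intros Hab Hd.
  destruct (MVT_gen f a b df) as [x [Hx He]].
  - intros x Hx. rewrite Rmin_left, Rmax_right in Hx by lra. apply Hd; lra.
  - intros x Hx. rewrite Rmin_left, Rmax_right in Hx by lra.
    apply continuity_pt_filterlim, (ex_derive_continuous f).
    exists (df x). apply Hd; lra.
  - rewrite Rmin_left, Rmax_right in Hx by lra. exists x; auto.
Qed.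

Lemma ex_antiderivative (f : R -> R) :
  (forall x, continuous f x) -> exists F, forall x, is_derive F x (f x).
Proof.
  intros Hc. exists (RInt f 0). intros x.
  refine (is_derive_RInt f (RInt f 0) 0 x _ (Hc x)).
  apply filter_forall. intros y. refine (RInt_correct f 0 y _).
  refine (ex_RInt_continuous f 0 y _). intros z _. apply Hc.
Qed.

(** With k = C / eps, the derivative bound makes E - k e^{eps s} nonincreasing and E + k e^{eps s}
    nondecreasing. The supremum of the former lies below all values of the latter and is the limit
    at -oo. *)
Lemma limit_of_exp_deriv (E dE : R -> R) (S C eps : R) :
  0 < eps ->
  (forall s, s <= S -> is_derive E s (dE s)) ->
  (forall s, s <= S -> Rabs (dE s) <= C * exp (eps * s)) ->
  exists l, forall s, s <= S -> Rabs (E s - l) <= C / eps * exp (eps * s).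
Proof.
  intros He Hd Hb.
  set (k := C / eps).
  assert (Hk : k * eps = C) by (unfold k; field; lra).
  assert (Hlo : forall t s, t <= s -> s <= S ->
            E s - k * exp (eps * s) <= E t - k * exp (eps * t)).
  { intros t s Hts Hs.
    assert (- (E t - k * exp (eps * t)) <= - (E s - k * exp (eps * s))); [|lra].
    apply (le_of_deriv_nonneg (fun s => - (E s - k * exp (eps * s)))
             (fun s => - (dE s - C * exp (eps * s)))); [lra| |].
    - intros x Hx. specialize (Hd x ltac:(lra)). derive. rewrite <- Hk. ring.
    - intros x Hx. specialize (Hb x ltac:(lra)). apply Rabs_le_between in Hb. lra. }
  assert (Hhi : forall t s, t <= s -> s <= S ->
            E t + k * exp (eps * t) <= E s + k * exp (eps * s)).
  { intros t s Hts Hs.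
    apply (le_of_deriv_nonneg (fun s => E s + k * exp (eps * s))
             (fun s => dE s + C * exp (eps * s))); [lra| |].
    - intros x Hx. specialize (Hd x ltac:(lra)). derive. rewrite <- Hk. ring.
    - intros x Hx. specialize (Hb x ltac:(lra)). apply Rabs_le_between in Hb. lra. }
  assert (HC : 0 <= C).
  { specialize (Hb S (Rle_refl _)). pose proof (Rabs_pos (dE S)).
    pose proof (exp_pos (eps * S)). nra. }
  assert (Hk0 : forall s, 0 <= k * exp (eps * s)).
  { intros s. apply Rmult_le_pos; [|left; apply exp_pos].
    apply Rmult_le_pos; [lra|left; apply Rinv_0_lt_compat; lra]. }
  assert (Hcross : forall t s, t <= S -> s <= S ->
            E s - k * exp (eps * s) <= E t + k * exp (eps * t)).
  { intros t s Ht Hs. pose proof (Hk0 t). pose proof (Hk0 s).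
    destruct (Rle_dec t s).
    - specialize (Hhi t s ltac:(lra) Hs). specialize (Hlo t s ltac:(lra) Hs). lra.
    - specialize (Hhi s t ltac:(lra) Ht). specialize (Hlo s t ltac:(lra) Ht). lra. }
  destruct (completeness (fun v => exists s, s <= S /\ v = E s - k * exp (eps * s)))
    as [l [Hub Hlub]].
  - exists (E S + k * exp (eps * S)). intros v [s [Hs ->]]. apply Hcross; lra.
  - exists (E S - k * exp (eps * S)). exists S. split; lra.
  - exists l. intros s Hs. apply Rabs_le_between. split.
    + assert (l <= E s + k * exp (eps * s)); [|lra].
      apply Hlub. intros v [t [Ht ->]]. apply Hcross; lra.
    + assert (E s - k * exp (eps * s) <= l); [|lra].
      apply Hub. exists s; auto.
Qed.

(** * Supersolutions of w'' - c w' - w = 0 and the strong maximum principle *)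

(** With rho = mu - c = 1 / mu, the operator D^2 - c D - 1 factors as (D + rho)(D - mu), so v =
    e^{rho s} (w' - mu w) is nonincreasing. A positive value of v at s0 keeps w' above a positive
    constant on all of (-oo, s0], which drives w below 0. *)
Lemma supersolution_deriv_le (c mu : R) (w w1 w2 : R -> R) :
  0 < mu -> mu * mu - c * mu - 1 = 0 ->
  (forall s, is_derive w s (w1 s)) -> (forall s, is_derive w1 s (w2 s)) ->
  (forall s, 0 <= w s) -> (forall s, w2 s - c * w1 s - w s <= 0) ->
  forall s, w1 s <= mu * w s.
Proof.
  intros Hmu Hroot Hw Hw1 Hpos Hle s0.
  destruct (Rle_dec (w1 s0) (mu * w s0)) as [|Hn]; [assumption|exfalso].
  set (rho := mu - c).
  assert (Hrho : 0 < rho) by (unfold rho; nra).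
  set (v := fun s => exp (rho * s) * (w1 s - mu * w s)).
  assert (Hv : forall s t, s <= t -> v t <= v s).
  { intros s t Hst.
    assert (- v s <= - v t); [|lra].
    apply (le_of_deriv_nonneg (fun s => - v s)
      (fun s => - (exp (rho * s) * (w2 s - c * w1 s - w s)))); [lra| |].
    - intros x _. unfold v. derive. apply Rminus_diag_uniq.
      transitivity ((mu * mu - c * mu - 1) * (exp (rho * x) * w x));
        [unfold rho; ring|rewrite Hroot; ring].
    - intros x _. pose proof (exp_pos (rho * x)). specialize (Hle x). nra. }
  set (k := w1 s0 - mu * w s0).
  assert (Hk : 0 < k) by (unfold k; lra).
  assert (Hw1k : forall s, s <= s0 -> k <= w1 s).
  { intros s Hs. specialize (Hv s s0 Hs). unfold v in Hv. fold k in Hv.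
    assert (exp (rho * s) <= exp (rho * s0)).
    { destruct (Rle_lt_or_eq_dec _ _ Hs) as [Hs'| ->]; [|lra].
      left. apply exp_increasing. nra. }
    pose proof (exp_pos (rho * s)). specialize (Hpos s).
    assert (k <= w1 s - mu * w s) by nra. nra. }
  (* At this abscissa the line of slope k through (s0, w s0) has the value -1. *)
  set (t := s0 - (w s0 + 1) / k).
  assert (Hq : 0 <= (w s0 + 1) / k).
  { apply Rmult_le_pos; [specialize (Hpos s0); lra|left; apply Rinv_0_lt_compat; lra]. }
  assert (w t - k * t <= w s0 - k * s0).
  { apply (le_of_deriv_nonneg (fun s => w s - k * s) (fun s => w1 s - k)).
    - unfold t; lra.
    - intros x _. derive. ring.
    - intros x Hx. specialize (Hw1k x ltac:(lra)). lra. }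
  assert (k * (s0 - t) = w s0 + 1) by (unfold t; field; lra).
  specialize (Hpos t). lra.
Qed.

(** To the right of the zero, z = e^{-mu s} w is nonnegative and nonincreasing. The zero is a
    minimum, so w' vanishes there too; then e^{rho s} (w' - mu w), nonincreasing and zero at s0, is
    nonnegative to the left of s0, where z is therefore nondecreasing and squeezed to 0 as well. *)
Lemma supersolution_eq_zero (c mu : R) (w w1 w2 : R -> R) (s0 : R) :
  0 < mu -> mu * mu - c * mu - 1 = 0 ->
  (forall s, is_derive w s (w1 s)) -> (forall s, is_derive w1 s (w2 s)) ->
  (forall s, 0 <= w s) -> (forall s, w2 s - c * w1 s - w s <= 0) ->
  w s0 = 0 -> forall s, w s = 0.
Proof.
  intros Hmu Hroot Hw Hw1 Hpos Hle H0.
  pose proof (supersolution_deriv_le c mu w w1 w2 Hmu Hroot Hw Hw1 Hpos Hle) as Hv0.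
  set (rho := mu - c).
  set (z := fun s => exp (- mu * s) * w s).
  assert (Hz : forall s, is_derive z s (exp (- mu * s) * (w1 s - mu * w s))).
  { intros x. unfold z. derive. ring. }
  assert (Hback : forall s, z s = 0 -> w s = 0).
  { intros s Hs. unfold z in Hs. pose proof (exp_pos (- mu * s)).
    apply Rmult_integral in Hs. destruct Hs; lra. }
  assert (Hz0 : z s0 = 0) by (unfold z; rewrite H0; ring).
  assert (Hw10 : w1 s0 = 0).
  { pose proof (proj1 (is_derive_Reals _ _ _) (Hw s0)) as Hd.
    rewrite <- (derive_pt_eq_0 w s0 (w1 s0) (exist _ _ Hd) Hd).
    apply (deriv_minimum w (s0 - 1) (s0 + 1)); try lra.
    intros x _ _. rewrite H0. apply Hpos. }
  intros s. apply Hback. destruct (Rle_dec s0 s) as [Hs|Hs].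
  - apply Rle_antisym.
    + assert (- z s0 <= - z s); [|lra].
      apply (le_of_deriv_nonneg (fun s => - z s)
               (fun s => - (exp (- mu * s) * (w1 s - mu * w s)))); [lra| |].
      * intros x _. derive. ring.
      * intros x _. specialize (Hv0 x). pose proof (exp_pos (- mu * x)). nra.
    + unfold z. apply Rmult_le_pos; [left; apply exp_pos|apply Hpos].
  - assert (Hv : forall t, t <= s0 -> 0 <= w1 t - mu * w t).
    { intros t Ht.
      assert (- (exp (rho * t) * (w1 t - mu * w t)) <=
              - (exp (rho * s0) * (w1 s0 - mu * w s0))) as Hv.
      { apply (le_of_deriv_nonneg (fun s => - (exp (rho * s) * (w1 s - mu * w s)))
          (fun s => - (exp (rho * s) * (w2 s - c * w1 s - w s)))); [lra| |].
        - intros x _. derive. apply Rminus_diag_uniq.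
      transitivity ((mu * mu - c * mu - 1) * (exp (rho * x) * w x));
        [unfold rho; ring|rewrite Hroot; ring].
        - intros x _. pose proof (exp_pos (rho * x)). specialize (Hle x). nra. }
      rewrite Hw10, H0 in Hv. pose proof (exp_pos (rho * t)). nra. }
    apply Rle_antisym.
    + rewrite <- Hz0. apply (le_of_deriv_nonneg z
               (fun s => (exp (- mu * s) * (w1 s - mu * w s)))); [lra| |].
      * intros x _. apply Hz.
      * intros x Hx. specialize (Hv x ltac:(lra)). pose proof (exp_pos (- mu * x)). nra.
    + unfold z. apply Rmult_le_pos; [left; apply exp_pos|apply Hpos].
Qed.

(** * Exponential decay from a Lyapunov function *)

Lemma exp_INR_mult (n : nat) (a : R) : exp (INR n * a) = exp a ^ n.
Proof.
  induction n as [|n IH].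
  - simpl. rewrite Rmult_0_l. apply exp_0.
  - rewrite S_INR, Rmult_plus_distr_r, exp_plus, IH, Rmult_1_l. simpl. ring.
Qed.

Lemma exp_le_exp (x y : R) : x <= y -> exp x <= exp y.
Proof.
  intros [H | ->]; [left; apply exp_increasing; assumption|lra].
Qed.

(** The two signs of H are treated differently. If H exceeded K e^{eps t} somewhere, the excess
    would be multiplied by at least 1 + 1/C at each step of length tau to the left, against
    subexponential growth. For -H the inequality gives -H(t - tau) <= (1 - 1/C)(-H(t)) + (K/C)
    e^{eps t}, a contraction whose iteration yields the decay. *)
Lemma exp_decay_of_delay_inequality (H : R -> R) (tau C K eps S M0 : R) :
  0 < tau -> 1 < C -> 0 <= K -> 0 < eps -> S <= 0 ->
  (forall t, t <= S -> Rabs (H t) <= C * (H (t - tau) - H t) + K * exp (eps * t)) ->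
  (forall t, t <= S -> - H t <= M0) ->
  (forall eta, 0 < eta -> exists M S', forall t, t <= S' ->
     Rabs (H t) <= M * exp (- eta * t)) ->
  exists M eps', 0 < eps' /\ forall t, t <= S -> Rabs (H t) <= M * exp (eps' * t).
Proof.
  intros Htau HC HK Heps HS Hdel Hlow Hsub.
  assert (HC' : 0 < / C < 1).
  { split; [apply Rinv_0_lt_compat; lra|].
    rewrite <- Rinv_1. apply Rinv_lt_contravar; lra. }
  assert (HCC : C * / C = 1) by (field; lra).
  assert (Hup : forall t, t <= S -> H t <= K * exp (eps * t)).
  { intros t0 Ht0. apply Rnot_lt_le. intros Hlt.
    set (G := fun t => H t - K * exp (eps * t)).
    assert (HG0 : 0 < G t0) by (unfold G; lra).
    assert (Hstep : forall t, t <= S -> (1 + / C) * G t <= G (t - tau)).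
    { intros t Ht. specialize (Hdel t Ht). pose proof (Rle_abs (H t)).
      assert (K * exp (eps * (t - tau)) <= K * exp (eps * t)).
      { apply Rmult_le_compat_l; [lra|]. apply exp_le_exp. nra. }
      assert (0 <= K * exp (eps * t)).
      { apply Rmult_le_pos; [lra|left; apply exp_pos]. }
      assert (H t - K * exp (eps * t) <= C * (H (t - tau) - H t)) by lra.
      assert (/ C * (H t - K * exp (eps * t)) <= H (t - tau) - H t).
      { replace (H (t - tau) - H t) with (/ C * (C * (H (t - tau) - H t))) by (field; lra).
        apply Rmult_le_compat_l; lra. }
      unfold G. lra. }
    (* The excess grows like b^(2n) after n steps, while the rate eta = ln b / tau allows H only
       b^n; the square root provides this gap. *)
    set (b := sqrt (1 + / C)).
    assert (Hbb : b * b = 1 + / C) by (apply sqrt_sqrt; lra).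
    assert (Hb : 1 < b).
    { unfold b. rewrite <- sqrt_1 at 1. apply sqrt_lt_1; lra. }
    assert (Hiter : forall n : nat, b ^ n * b ^ n * G t0 <= G (t0 - INR n * tau)).
    { induction n as [|n IH].
      - simpl. rewrite Rmult_0_l, Rminus_0_r. lra.
      - rewrite S_INR. replace (t0 - (INR n + 1) * tau) with (t0 - INR n * tau - tau) by ring.
        eapply Rle_trans; [|apply Hstep].
        + simpl. rewrite <- Hbb.
          replace (b * b ^ n * (b * b ^ n) * G t0) with (b * b * (b ^ n * b ^ n * G t0)) by ring.
          apply Rmult_le_compat_l; [apply Rle_0_sqr|exact IH].
        + pose proof (pos_INR n). nra. }
    set (eta := ln b / tau).
    assert (Heta : 0 < eta).
    { unfold eta. apply Rdiv_lt_0_compat; [|lra]. rewrite <- ln_1. apply ln_increasing; lra. }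
    destruct (Hsub eta Heta) as [M [S' HM]].
    destruct (Pow_x_infinity b) with (b := (M * exp (- eta * t0) / G t0 + 1)) as [N HN].
    { rewrite Rabs_pos_eq; lra. }
    destruct (INR_unbounded ((t0 - S') / tau)) as [N' HN'].
    set (n := (N + N')%nat).
    assert (Hn : t0 - INR n * tau <= S').
    { assert (INR N' <= INR n) by (apply le_INR; unfold n; lia).
      assert (t0 - S' = (t0 - S') / tau * tau) by (field; lra). nra. }
    specialize (HM _ Hn). specialize (HN n ltac:(unfold n; lia)). specialize (Hiter n).
    assert (Hbn : 0 < b ^ n) by (apply pow_lt; lra).
    rewrite Rabs_pos_eq in HN by lra.
    replace (- eta * (t0 - INR n * tau)) with (- eta * t0 + INR n * (eta * tau)) in HM by ring.
    rewrite exp_plus, exp_INR_mult in HM.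
    replace (eta * tau) with (ln b) in HM by (unfold eta; field; lra).
    rewrite exp_ln in HM by lra.
    assert (HGH : G (t0 - INR n * tau) <= Rabs (H (t0 - INR n * tau))).
    { unfold G. pose proof (Rle_abs (H (t0 - INR n * tau))).
      pose proof (exp_pos (eps * (t0 - INR n * tau))). nra. }
    assert (H1 : b ^ n * (b ^ n * G t0) <= b ^ n * (M * exp (- eta * t0))) by lra.
    apply Rmult_le_reg_l in H1; [|assumption].
    assert ((M * exp (- eta * t0) / G t0 + 1) * G t0 <= b ^ n * G t0)
      by (apply Rmult_le_compat_r; lra).
    replace ((M * exp (- eta * t0) / G t0 + 1) * G t0)
      with (M * exp (- eta * t0) + G t0) in H0 by (field; lra).
    lra. }
  (* Weaker than the contraction factor 1 - 1/C: the spare 1/(2C) absorbs the forcing, which is why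
     M contains 2 K. *)
  set (r := 1 - / C / 2).
  assert (Hr : 0 < r < 1) by (unfold r; lra).
  set (e' := Rmin eps (- ln r / tau)).
  assert (Hln : ln r < 0) by (rewrite <- ln_1; apply ln_increasing; lra).
  assert (He' : 0 < e').
  { unfold e'. apply Rmin_glb_lt; [lra|]. apply Rdiv_lt_0_compat; lra. }
  assert (Her : r <= exp (- (e' * tau))).
  { rewrite <- (exp_ln r) by lra. apply exp_le_exp.
    assert (e' * tau <= - ln r / tau * tau)
      by (apply Rmult_le_compat_r; [lra|apply Rmin_r]).
    replace (- ln r / tau * tau) with (- ln r) in H0 by (field; lra). lra. }
  assert (Hee : forall t, t <= S -> exp (eps * t) <= exp (e' * t)).
  { intros t Ht. apply exp_le_exp. pose proof (Rmin_l eps (- ln r / tau)). fold e' in H0. nra. }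
  set (M := Rabs M0 * exp (- (e' * (S - tau))) + 2 * K).
  assert (HM : 0 <= Rabs M0 * exp (- (e' * (S - tau)))).
  { apply Rmult_le_pos; [apply Rabs_pos|left; apply exp_pos]. }
  assert (Hdown : forall (n : nat) t, S - INR n * tau <= t -> t <= S -> - H t <= M * exp (e' * t)).
  { assert (Hbase : forall t, S - tau <= t -> t <= S -> - H t <= M * exp (e' * t)).
    { intros t H1 H2. specialize (Hlow t H2). pose proof (Rle_abs M0).
      assert (1 <= exp (- (e' * (S - tau))) * exp (e' * t)).
      { rewrite <- exp_plus, <- exp_0 at 1. apply exp_le_exp. nra. }
      pose proof (exp_pos (e' * t)). pose proof (Rabs_pos M0).
      assert (Rabs M0 * 1 <= Rabs M0 * (exp (- (e' * (S - tau))) * exp (e' * t)))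
        by (apply Rmult_le_compat_l; lra).
      unfold M. nra. }
    induction n as [|n IH]; intros t H1 H2.
    - simpl in H1. apply Hbase; lra.
    - rewrite S_INR in H1. destruct (Rle_dec (S - tau) t) as [H3|H3]; [apply Hbase; lra|].
      set (s := t + tau).
      assert (Hs : s <= S) by (unfold s; lra).
      specialize (IH s ltac:(unfold s; lra) Hs). specialize (Hdel s Hs).
      replace (s - tau) with t in Hdel by (unfold s; ring).
      pose proof (Rle_abs (- H s)) as Habs. rewrite Rabs_Ropp in Habs.
      pose proof (Hee s Hs). pose proof (exp_pos (e' * s)) as HE.
      assert (K * exp (eps * s) <= K * exp (e' * s)) by (apply Rmult_le_compat_l; lra).
      assert (C * - H t <= (C - 1) * (M * exp (e' * s)) + K * exp (e' * s)) by nra.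
      assert (C * (r * (M * exp (e' * s))) <= C * (exp (- (e' * tau)) * (M * exp (e' * s)))).
      { apply Rmult_le_compat_l; [lra|]. apply Rmult_le_compat_r; [|lra].
        apply Rmult_le_pos; [unfold M|]; lra. }
      assert (K * exp (e' * s) <= / 2 * M * exp (e' * s)).
      { apply Rmult_le_compat_r; [|unfold M]; lra. }
      apply Rmult_le_reg_l with C; [lra|].
      replace (e' * t) with (- (e' * tau) + e' * s) by (unfold s; ring).
      rewrite exp_plus.
      replace (C * (r * (M * exp (e' * s)))) with ((C - / 2) * (M * exp (e' * s))) in H6.
      + lra.
      + unfold r. field. lra. }
  exists M, e'. split; [assumption|]. intros t Ht.
  apply Rabs_le_between. split.
  - destruct (INR_unbounded ((S - t) / tau)) as [n Hn].
    assert (- H t <= M * exp (e' * t)); [|lra].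
    apply (Hdown n); [|assumption].
    assert (S - t = (S - t) / tau * tau) by (field; lra). nra.
  - eapply Rle_trans; [apply Hup; assumption|].
    apply Rmult_le_compat; try lra; [left; apply exp_pos|unfold M; lra|apply Hee; assumption].
Qed.

(** * The linear delay equation at a critical rate *)

(** Cauchy-Schwarz for p' = u, obtained by integrating (u - k)^2 >= 0 with k = (p b - p a) / (s -
    t). The interval [a, b] is kept apart from [t, s] so that one bound serves all increments inside
    a window. *)
Lemma sq_increment_le (p u W : R -> R) (t a b s : R) :
  (forall x, is_derive p x (u x)) -> (forall x, is_derive W x (u x * u x)) ->
  t <= a -> a <= b -> b <= s -> t < s ->
  (p b - p a) * (p b - p a) <= (s - t) * (W s - W t).
Proof.
  intros Hp HW Hta Hab Hbs Hts.
  assert (HWm : forall x y, x <= y -> W x <= W y).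
  { intros x y Hxy. apply (le_of_deriv_nonneg W (fun x => u x * u x)); auto.
    intros z _. apply Rle_0_sqr. }
  set (k := (p b - p a) / (s - t)).
  assert (Hk : k * (s - t) = p b - p a) by (unfold k; field; lra).
  assert (Hm : W a - 2 * k * p a + k * k * a <= W b - 2 * k * p b + k * k * b).
  { apply (le_of_deriv_nonneg (fun x => W x - 2 * k * p x + k * k * x)
             (fun x => (u x - k) * (u x - k))); auto.
    - intros x _. derive. ring.
    - intros x _. apply Rle_0_sqr. }
  pose proof (HWm t a Hta). pose proof (HWm b s Hbs).
  assert (k * k * (b - a) <= k * k * (s - t)) by (apply Rmult_le_compat_l; [apply Rle_0_sqr|lra]).
  assert (H2 : k * (p b - p a) <= W s - W t).
  { replace (k * k * (s - t)) with (k * (p b - p a)) in H1 by (rewrite <- Hk; ring). lra. }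
  rewrite <- Hk at 1. replace (k * (s - t) * (p b - p a)) with ((s - t) * (k * (p b - p a))) by ring.
  apply Rmult_le_compat_l; lra.
Qed.

Lemma sq_le_of_abs_le (x e : R) : Rabs x <= e -> x * x <= e * e.
Proof.
  intros H.
  apply Rsqr_le_abs_1. rewrite (Rabs_pos_eq e); [assumption|].
  pose proof (Rabs_pos x); lra.
Qed.

(** The dissipation over a window, D = int u^2, also bounds |H| up to the forcing: [Q] measures only
    the oscillation of p, and when m <> 0 the equation recovers m p from u, f and that oscillation.
    Hence a delay inequality for H, its exponential decay, and that of D. For m = 0 only p' becomes
    small, and p keeps an arbitrary limit; a nonzero m forces the limit 0. *)
Lemma delay_solution_converges (tau B m eps S Cf : R) (p u P f : R -> R) :
  0 < tau -> 0 < B -> S <= 0 -> 0 < eps ->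
  (forall s, is_derive P s (p s)) -> (forall s, is_derive p s (u s)) ->
  (forall s, continuous u s) ->
  (forall s, s <= S -> u s + m * p s + B * (tau * p s - (P s - P (s - tau))) = f s) ->
  (forall s, s <= S -> Rabs (f s) <= Cf * exp (eps * s)) ->
  (forall eta, 0 < eta -> exists M S', forall s, s <= S' -> Rabs (p s) <= M * exp (- eta * s)) ->
  exists l M eps', 0 < eps' /\ (m <> 0 -> l = 0) /\
    forall s, s <= S -> Rabs (p s - l) <= M * exp (eps' * s).
Proof.
  intros Htau HB HS Heps HP Hp Hu Heq Hf Hsub.
  assert (Hpc : forall s, continuous p s).
  { intros s. apply (ex_derive_continuous p). eexists; eauto. }
  destruct (ex_antiderivative (fun s => p s * p s)) as [Rp HRp].
  { intros s. apply (continuous_mult p p); auto. }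
  destruct (ex_antiderivative (fun s => u s * u s)) as [W HW].
  { intros s. apply (continuous_mult u u); auto. }
  (* [Q s] is [B / 2] times the integral of [(p s - p x)^2] over [x] in [s - tau, s]; the Lyapunov
     function is [H = Q + m p^2 / 2], with [H' <= - u^2 / 2 + f^2 / 2]. *)
  set (Q := fun s => B / 2 * (tau * (p s * p s) - 2 * p s * (P s - P (s - tau)) + (Rp s - Rp (s - tau)))).
  set (H := fun s => Q s + m / 2 * (p s * p s)).
  assert (HCf : 0 <= Cf).
  { specialize (Hf S (Rle_refl _)). pose proof (Rabs_pos (f S)).
    pose proof (exp_pos (eps * S)). nra. }
  (* [Kf] e^{2 eps s} is an antiderivative of Cf^2 e^{2 eps s} / 2, the bound for f^2 / 2. *)
  set (Kf := Cf * Cf / (4 * eps)).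
  assert (HKf : 0 <= Kf).
  { unfold Kf. apply Rmult_le_pos; [nra|]. left; apply Rinv_0_lt_compat; lra. }
  assert (Hdiss : forall t s, t <= s -> s <= S ->
            (W s - W t) / 2 + H s - H t <= Kf * exp (2 * eps * s)).
  { intros t s Hts Hs.
    assert (Hm : - (W t / 2 + H t - Kf * exp (2 * eps * t)) <=
                 - (W s / 2 + H s - Kf * exp (2 * eps * s))).
    { apply (le_of_deriv_nonneg (fun s => - (W s / 2 + H s - Kf * exp (2 * eps * s)))
        (fun s => - (u s * u s / 2
                     + (u s * (m * p s + B * (tau * p s - (P s - P (s - tau))))
                        - B / 2 * ((p s - p (s - tau)) * (p s - p (s - tau))))
                     - Cf * Cf / 2 * exp (2 * eps * s)))); [lra| |].
      - intros x _. unfold H, Q. derive. unfold Kf, Rminus. field. lra.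
      - intros x Hx. specialize (Heq x ltac:(lra)). specialize (Hf x ltac:(lra)).
        replace (m * p x + B * (tau * p x - (P x - P (x - tau)))) with (f x - u x) by lra.
        replace (2 * eps * x) with (eps * x + eps * x) by ring. rewrite exp_plus.
        assert (f x * f x <= (Cf * exp (eps * x)) * (Cf * exp (eps * x))).
        { apply sq_le_of_abs_le; assumption. }
        pose proof (Rle_0_sqr (u x - f x)) as H1. unfold Rsqr in H1.
        assert (0 <= B / 2 * ((p x - p (x - tau)) * (p x - p (x - tau)))).
        { apply Rmult_le_pos; [lra|apply Rle_0_sqr]. }
        lra. }
    pose proof (exp_pos (2 * eps * t)). nra. }
  (* Length 2 tau rather than tau: the equation is used at points of [s - tau, s] and looks back
     from there by a further tau. *)
  set (D := fun s => W s - W (s - 2 * tau)).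
  assert (HWm : forall x y, x <= y -> W x <= W y).
  { intros x y Hxy. apply (le_of_deriv_nonneg W (fun x => u x * u x)); auto.
    intros z _. apply Rle_0_sqr. }
  assert (HD0 : forall s, 0 <= D s).
  { intros s. unfold D. specialize (HWm (s - 2 * tau) s ltac:(lra)). lra. }
  set (d := fun s => sqrt (2 * tau * D s)).
  assert (Hdd : forall s, d s * d s = 2 * tau * D s).
  { intros s. apply sqrt_sqrt. specialize (HD0 s). nra. }
  assert (Hd0 : forall s, 0 <= d s) by (intros; apply sqrt_pos).
  assert (Hosc : forall s a b, s - 2 * tau <= a <= s -> s - 2 * tau <= b <= s ->
            Rabs (p a - p b) <= d s).
  { intros s a b Ha Hb. apply Rsqr_incr_0_var; [|apply Hd0].
    rewrite <- Rsqr_abs. unfold Rsqr. rewrite Hdd.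
    replace (2 * tau * D s) with ((s - (s - 2 * tau)) * (W s - W (s - 2 * tau)))
      by (unfold D; ring).
    destruct (Rle_dec a b).
    - replace ((p a - p b) * (p a - p b)) with ((p b - p a) * (p b - p a)) by ring.
      apply (sq_increment_le p u W); auto; lra.
    - apply (sq_increment_le p u W); auto; lra. }
  assert (Hmean : forall s a, s - tau <= a <= s ->
            Rabs (tau * p a - (P a - P (a - tau))) <= tau * d s).
  { intros s a Ha.
    destruct (mvt_deriv P p (a - tau) a) as [x [Hx He]]; [lra|auto|].
    rewrite He. replace (tau * p a - p x * (a - (a - tau))) with (tau * (p a - p x)) by ring.
    rewrite Rabs_mult, Rabs_pos_eq by lra. apply Rmult_le_compat_l; [lra|].
    apply Hosc; lra. }
  assert (HQ : forall s e, (forall a, s - tau <= a <= s -> Rabs (p s - p a) <= e) ->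
            0 <= Q s <= B / 2 * (tau * (e * e))).
  { intros s e He.
    destruct (mvt_deriv (fun a => p s * p s * a - 2 * p s * P a + Rp a)
               (fun a => (p s - p a) * (p s - p a)) (s - tau) s) as [x [Hx Heq']]; [lra| |].
    - intros x _. derive. ring.
    - assert (Q s = B / 2 * (tau * ((p s - p x) * (p s - p x)))) as ->.
      { unfold Q. replace (tau * ((p s - p x) * (p s - p x)))
          with ((p s - p x) * (p s - p x) * (s - (s - tau))) by ring.
        rewrite <- Heq'. ring. }
      specialize (He x Hx).
      assert (0 <= (p s - p x) * (p s - p x) <= e * e).
      { split; [apply Rle_0_sqr|]. apply sq_le_of_abs_le; assumption. }
      split; [apply Rmult_le_pos; [lra|]; apply Rmult_le_pos; lra|].
      apply Rmult_le_compat_l; [lra|]. apply Rmult_le_compat_l; lra. }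
  assert (Hpd : exists a, 0 <= a /\ (forall s, s <= S -> Rabs m * (p s * p s) <=
              a * (D s + exp (2 * eps * s))) /\
            (m <> 0 -> forall s, s <= S -> p s * p s <= a * (D s + exp (2 * eps * s)))).
  { destruct (Req_dec m 0) as [Hm | Hm].
    - exists 0. split; [lra|split; [|tauto]]. intros s _. rewrite Hm, Rabs_R0. lra.
    - set (b := 1 + (Cf + / tau + B * tau) / Rabs m).
      assert (Hm0 : 0 < Rabs m) by (apply Rabs_pos_lt; assumption).
      assert (Htau' : 0 < / tau) by (apply Rinv_0_lt_compat; lra).
      assert (HBt : 0 < B * tau) by (apply Rmult_lt_0_compat; lra).
      assert (Hpb : forall s, s <= S -> p s * p s <= (2 * (b * b) * (2 * tau + 1)) * (D s + exp (2 * eps * s))).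
      { intros s Hs.
        (* At x the value of u is the mean slope of p over [s - tau, s], hence at most d s / tau in
           size; the equation at x then bounds m p(x). *)
        destruct (mvt_deriv p u (s - tau) s) as [x [Hx He]]; [lra|auto|].
        assert (Hux : Rabs (u x) <= / tau * d s).
        { apply Rmult_le_reg_l with tau; [lra|]. rewrite <- Rmult_assoc, Rinv_r, Rmult_1_l by lra.
          rewrite <- (Rabs_pos_eq tau) by lra. rewrite <- Rabs_mult.
          replace (tau * u x) with (u x * (s - (s - tau))) by ring. rewrite <- He.
          apply Hosc; lra. }
        assert (Hpx : Rabs m * Rabs (p x) <= (Cf + / tau + B * tau) * (d s + exp (eps * s))).
        { rewrite <- Rabs_mult.
          replace (m * p x) with (f x - u x - B * (tau * p x - (P x - P (x - tau))))
            by (rewrite <- Heq by lra; ring).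
          specialize (Hmean s x Hx). specialize (Hf x ltac:(lra)).
          assert (exp (eps * x) <= exp (eps * s)) by (apply exp_le_exp; nra).
          assert (Cf * exp (eps * x) <= Cf * exp (eps * s)) by (apply Rmult_le_compat_l; lra).
          assert (Rabs (B * (tau * p x - (P x - P (x - tau)))) <= B * (tau * d s)).
          { rewrite Rabs_mult, Rabs_pos_eq by lra. apply Rmult_le_compat_l; lra. }
          pose proof (exp_pos (eps * s)). specialize (Hd0 s).
          assert (0 <= Cf * d s) by (apply Rmult_le_pos; lra).
          assert (0 <= / tau * exp (eps * s)) by (apply Rmult_le_pos; lra).
          assert (0 <= B * tau * exp (eps * s)) by (apply Rmult_le_pos; lra).
          eapply Rle_trans; [apply Rabs_triang|]. rewrite Rabs_Ropp.
          eapply Rle_trans; [apply Rplus_le_compat_r, Rabs_triang|]. rewrite Rabs_Ropp.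
          lra. }
        assert (Hps : Rabs (p s) <= b * (d s + exp (eps * s))).
        { assert (Rabs (p x) <= (Cf + / tau + B * tau) / Rabs m * (d s + exp (eps * s))).
          { apply Rmult_le_reg_l with (Rabs m); [assumption|].
            replace (Rabs m * ((Cf + / tau + B * tau) / Rabs m * (d s + exp (eps * s))))
              with ((Cf + / tau + B * tau) * (d s + exp (eps * s))) by (field; lra).
            assumption. }
          assert (Hsx : Rabs (p s - p x) <= d s) by (apply Hosc; lra).
          pose proof (exp_pos (eps * s)).
          replace (p s) with (p x + (p s - p x)) by ring.
          eapply Rle_trans; [apply Rabs_triang|]. unfold b. lra. }
        assert (p s * p s <= (b * (d s + exp (eps * s))) * (b * (d s + exp (eps * s)))).
        { apply sq_le_of_abs_le; assumption. }
        assert ((d s + exp (eps * s)) * (d s + exp (eps * s)) <= 2 * (2 * tau + 1) * (D s + exp (2 * eps * s))).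
        { replace (2 * eps * s) with (eps * s + eps * s) by ring. rewrite exp_plus.
          pose proof (Rle_0_sqr (d s - exp (eps * s))) as H1. unfold Rsqr in H1.
          specialize (Hdd s). specialize (HD0 s).
          pose proof (Rle_0_sqr (exp (eps * s))) as H2. unfold Rsqr in H2.
          assert (0 <= tau * (exp (eps * s) * exp (eps * s))) by (apply Rmult_le_pos; lra).
          lra. }
        assert (b * b * ((d s + exp (eps * s)) * (d s + exp (eps * s))) <= b * b * (2 * (2 * tau + 1) * (D s + exp (2 * eps * s)))).
        { apply Rmult_le_compat_l; [apply Rle_0_sqr|assumption]. }
        lra. }
      set (a := 2 * (b * b) * (2 * tau + 1)) in *.
      assert (Ha : 0 <= a).
      { unfold a. pose proof (Rle_0_sqr b) as H1. unfold Rsqr in H1.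
        apply Rmult_le_pos; lra. }
      exists ((1 + Rabs m) * a).
      assert (HH : forall s, 0 <= a * (D s + exp (2 * eps * s))).
      { intros s. apply Rmult_le_pos; [assumption|]. specialize (HD0 s).
        pose proof (exp_pos (2 * eps * s)). lra. }
      split; [apply Rmult_le_pos; lra|split].
      + intros s Hs. specialize (Hpb s Hs). specialize (HH s).
        assert (Rabs m * (p s * p s) <= Rabs m * (a * (D s + exp (2 * eps * s))))
          by (apply Rmult_le_compat_l; lra). lra.
      + intros _ s Hs. specialize (Hpb s Hs). specialize (HH s).
        assert (0 <= Rabs m * (a * (D s + exp (2 * eps * s)))) by (apply Rmult_le_pos; lra).
        lra. }
  destruct Hpd as [a [Ha [Hpa Hpa']]].
  assert (HHb : forall s e, (forall a, s - tau <= a <= s -> Rabs (p s - p a) <= e) ->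
      Rabs (H s) <= B / 2 * (tau * (e * e)) + Rabs m * (p s * p s) / 2).
  { intros s e He. specialize (HQ s e He).
    unfold H. eapply Rle_trans; [apply Rabs_triang|].
    rewrite (Rabs_pos_eq (Q s)) by lra. rewrite Rabs_mult.
    rewrite (Rabs_pos_eq (p s * p s)) by apply Rle_0_sqr.
    unfold Rdiv. rewrite Rabs_mult, (Rabs_pos_eq (/ 2)) by lra. lra. }
  set (C1 := B * (tau * tau) + a + 1).
  assert (HBtt : 0 < B * (tau * tau)).
  { apply Rmult_lt_0_compat; [lra|]. apply Rmult_lt_0_compat; lra. }
  assert (HHD : forall s, s <= S -> Rabs (H s) <= C1 * (D s + exp (2 * eps * s))).
  { intros s Hs.
    assert (Hb := HHb s (d s) ltac:(intros; apply Hosc; lra)).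
    rewrite Hdd in Hb. specialize (Hpa s Hs). specialize (HD0 s).
    pose proof (exp_pos (2 * eps * s)).
    assert (0 <= B * (tau * tau) * exp (2 * eps * s)) by (apply Rmult_le_pos; lra).
    assert (0 <= a * (D s + exp (2 * eps * s))) by (apply Rmult_le_pos; lra).
    unfold C1. lra. }
  assert (HDH : forall s, s <= S -> D s <= 2 * (H (s - 2 * tau) - H s) + 2 * Kf * exp (2 * eps * s)).
  { intros s Hs. specialize (Hdiss (s - 2 * tau) s ltac:(lra) Hs). unfold D. lra. }
  destruct (exp_decay_of_delay_inequality H (2 * tau) (2 * C1) (C1 * (2 * Kf + 1)) (2 * eps) S
     (Rabs (H S) + Kf)) as [M [e' [He' HM]]]; try lra.
  - unfold C1. lra.
  - apply Rmult_le_pos; [unfold C1|]; lra.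
  - intros t Ht. specialize (HHD t Ht). specialize (HDH t Ht).
    assert (C1 * (D t + exp (2 * eps * t)) <=
      C1 * (2 * (H (t - 2 * tau) - H t) + 2 * Kf * exp (2 * eps * t) + exp (2 * eps * t))).
    { apply Rmult_le_compat_l; [unfold C1|]; lra. }
    lra.
  - intros t Ht. specialize (Hdiss t S Ht (Rle_refl _)). specialize (HWm t S Ht).
    assert (exp (2 * eps * S) <= 1) by (rewrite <- exp_0; apply exp_le_exp; nra).
    assert (Kf * exp (2 * eps * S) <= Kf * 1) by (apply Rmult_le_compat_l; lra).
    pose proof (Rle_abs (- H S)) as HA. rewrite Rabs_Ropp in HA. lra.
  - intros eta Heta. destruct (Hsub (eta / 2) ltac:(lra)) as [M [S' HM]].
    set (M2 := Rabs M * exp (eta / 2 * tau)).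
    exists (B / 2 * (tau * (2 * M2 * (2 * M2))) + Rabs m * (M2 * M2) / 2), S'.
    intros t Ht.
    assert (HM' : forall x, t - tau <= x <= t -> Rabs (p x) <= M2 * exp (- (eta / 2) * t)).
    { intros x Hx. specialize (HM x ltac:(lra)).
      eapply Rle_trans; [apply HM|]. unfold M2. rewrite Rmult_assoc, <- exp_plus.
      eapply Rle_trans;
        [apply Rmult_le_compat_r; [left; apply exp_pos|apply Rle_abs]|].
      apply Rmult_le_compat_l; [apply Rabs_pos|]. apply exp_le_exp. nra. }
    assert (Hb := HHb t (2 * M2 * exp (- (eta / 2) * t))).
    assert (HM2 : 0 <= M2) by (unfold M2; apply Rmult_le_pos; [apply Rabs_pos|left; apply exp_pos]).
    assert (HMt := HM' t ltac:(lra)).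
    eapply Rle_trans; [apply Hb|].
    + intros x Hx. specialize (HM' x Hx). unfold Rminus.
      eapply Rle_trans; [apply Rabs_triang|]. rewrite Rabs_Ropp. lra.
    + replace (- eta * t) with (- (eta / 2) * t + - (eta / 2) * t) by field.
      rewrite exp_plus. set (E := exp (- (eta / 2) * t)) in *.
      assert (p t * p t <= (M2 * E) * (M2 * E)).
      { apply sq_le_of_abs_le; assumption. }
      assert (Rabs m * (p t * p t) <= Rabs m * ((M2 * E) * (M2 * E)))
        by (apply Rmult_le_compat_l; [apply Rabs_pos|assumption]).
      lra.
  - set (e1 := Rmin e' (2 * eps)).
    assert (He1 : 0 < e1) by (apply Rmin_glb_lt; lra).
    assert (He1l : e1 <= e') by apply Rmin_l.
    assert (He1r : e1 <= 2 * eps) by apply Rmin_r.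
    assert (Hexp1 : forall s, s <= S -> exp (e' * s) <= exp (e1 * s)).
    { intros s Hs. apply exp_le_exp. nra. }
    assert (Hexp2 : forall s, s <= S -> exp (2 * eps * s) <= exp (e1 * s)).
    { intros s Hs. apply exp_le_exp. nra. }
    set (M1 := 4 * Rabs M + 2 * Kf).
    assert (HM1 : 0 <= M1) by (unfold M1; pose proof (Rabs_pos M); lra).
    assert (HHM : forall t, t <= S -> Rabs (H t) <= Rabs M * exp (e1 * t)).
    { intros t Ht. eapply Rle_trans; [apply HM; assumption|].
      eapply Rle_trans;
        [apply Rmult_le_compat_r; [left; apply exp_pos|apply Rle_abs]|].
      apply Rmult_le_compat_l; [apply Rabs_pos|]. apply Hexp1; assumption. }
    assert (HDM : forall s, s <= S -> D s <= M1 * exp (e1 * s)).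
    { intros s Hs. specialize (HDH s Hs).
      pose proof (HHM s Hs). pose proof (HHM (s - 2 * tau) ltac:(lra)).
      pose proof (Rle_abs (H (s - 2 * tau))).
      pose proof (Rle_abs (- H s)) as HA. rewrite Rabs_Ropp in HA.
      assert (exp (e1 * (s - 2 * tau)) <= exp (e1 * s)) by (apply exp_le_exp; nra).
      assert (Rabs M * exp (e1 * (s - 2 * tau)) <= Rabs M * exp (e1 * s))
        by (apply Rmult_le_compat_l; [apply Rabs_pos|assumption]).
      assert (Kf * exp (2 * eps * s) <= Kf * exp (e1 * s))
        by (apply Rmult_le_compat_l; auto).
      unfold M1. lra. }
    assert (Hhalf : forall s, exp (e1 / 2 * s) * exp (e1 / 2 * s) = exp (e1 * s)).
    { intros s. rewrite <- exp_plus. f_equal. field. }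
    (* The factor k + 1 stands for the square root of k, which it exceeds. *)
    assert (Hsq : forall x k s, 0 <= k -> x * x <= k * exp (e1 * s) ->
              Rabs x <= (k + 1) * exp (e1 / 2 * s)).
    { intros x k s Hk Hx. pose proof (exp_pos (e1 / 2 * s)) as HE.
      rewrite <- (Rabs_pos_eq ((k + 1) * _)) by (apply Rmult_le_pos; lra).
      apply Rsqr_le_abs_0. unfold Rsqr. eapply Rle_trans; [apply Hx|].
      rewrite <- Hhalf.
      replace ((k + 1) * exp (e1 / 2 * s) * ((k + 1) * exp (e1 / 2 * s)))
        with ((k + 1) * (k + 1) * (exp (e1 / 2 * s) * exp (e1 / 2 * s))) by ring.
      apply Rmult_le_compat_r; nra. }
    destruct (Req_dec m 0) as [Hm | Hm].
    + set (N := 2 * tau * M1 + 1).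
      assert (Hd : forall s, s <= S -> d s <= N * exp (e1 / 2 * s)).
      { intros s Hs. rewrite <- (Rabs_pos_eq (d s)) by apply Hd0.
        apply (Hsq (d s) (2 * tau * M1)); [apply Rmult_le_pos; lra|].
        rewrite Hdd, (Rmult_assoc (2 * tau) M1). apply Rmult_le_compat_l; [lra|]. apply HDM; assumption. }
      destruct (limit_of_exp_deriv p u S (Cf + B * (tau * N)) (e1 / 2)) as [l Hl]; [lra|auto| |].
      * intros s Hs. specialize (Heq s Hs). specialize (Hf s Hs). specialize (Hd s Hs).
        replace (u s) with (f s - B * (tau * p s - (P s - P (s - tau))))
          by (rewrite <- Heq, Hm; ring).
        assert (Rabs (B * (tau * p s - (P s - P (s - tau)))) <= B * (tau * (N * exp (e1 / 2 * s)))).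
        { rewrite Rabs_mult, Rabs_pos_eq by lra. apply Rmult_le_compat_l; [lra|].
          eapply Rle_trans; [apply (Hmean s s); lra|]. apply Rmult_le_compat_l; lra. }
        assert (exp (eps * s) <= exp (e1 / 2 * s)) by (apply exp_le_exp; nra).
        assert (Cf * exp (eps * s) <= Cf * exp (e1 / 2 * s)) by (apply Rmult_le_compat_l; lra).
        unfold Rminus at 1. eapply Rle_trans; [apply Rabs_triang|]. rewrite Rabs_Ropp. lra.
      * eexists l, _, (e1 / 2). split; [lra|split; [tauto|exact Hl]].
    + exists 0, (a * (M1 + 1) + 1), (e1 / 2). split; [lra|split; [auto|]].
      intros s Hs. rewrite Rminus_0_r. apply (Hsq (p s) (a * (M1 + 1))); [apply Rmult_le_pos; lra|].
      eapply Rle_trans; [apply Hpa'; assumption|]. rewrite (Rmult_assoc a (M1 + 1)).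
      apply Rmult_le_compat_l; [assumption|].
      specialize (HDM s Hs). specialize (Hexp2 s Hs). lra.
Qed.

(** * Wave profiles and their decay rate *)

(** Interface for all later estimates. Beyond the equation it collects consequences of it, the
    strict bound by kappa and phi' <= mu phi; the latter is meant with mu the positive root of x^2 -
    c x - 1, and tau stands for c h. *)
Record wave (g : R -> R) (kappa tau c mu : R) (phi d1 d2 : R -> R) : Prop := {
  wave_deriv : forall s, is_derive phi s (d1 s);
  wave_deriv2 : forall s, is_derive d1 s (d2 s);
  wave_eq : forall s, d2 s - c * d1 s - phi s + g (phi (s - tau)) = 0;
  wave_pos : forall s, 0 < phi s;
  wave_lt : forall s, phi s < kappa;
  wave_deriv_nonneg : forall s, 0 <= d1 s;
  wave_deriv_le : forall s, d1 s <= mu * phi s;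
  wave_left : forall eps, 0 < eps -> exists A, forall s, s <= A -> phi s < eps;
  wave_right : forall eps, 0 < eps -> exists A, forall s, A <= s -> kappa - eps < phi s
}.

Definition chi (g0 tau c l : R) : R := l * l - c * l - 1 + g0 * exp (- (l * tau)).

Definition linear_at_zero (g : R -> R) (g0 : R) : Prop :=
  forall eta, 0 < eta -> exists d, 0 < d /\
    forall u, 0 < u < d -> Rabs (g u - g0 * u) <= eta * u.

Definition decays (phi : R -> R) (l : R) : Prop :=
  exists K S, forall s, s <= S -> phi s <= K * exp (l * s).

Lemma deriv_nonneg_of_monotone (f : R -> R) (s l : R) :
  (forall x y, x <= y -> f x <= f y) -> is_derive f s l -> 0 <= l.
Proof.
  intros Hm Hd. apply is_derive_Reals in Hd.
  apply Rnot_lt_le. intros Hl. destruct (Hd (- l) ltac:(lra)) as [d Hd'].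
  pose proof (cond_pos d) as Hdp.
  specialize (Hd' (d / 2) ltac:(lra)).
  rewrite Rabs_pos_eq in Hd' by lra. specialize (Hd' ltac:(lra)).
  apply Rabs_def2 in Hd'.
  assert (0 <= (f (s + d / 2) - f s) / (d / 2)).
  { apply Rmult_le_pos; [|left; apply Rinv_0_lt_compat; lra].
    specialize (Hm s (s + d / 2) ltac:(lra)). lra. }
  lra.
Qed.

(** A nonincreasing positive profile cannot tend to 0 at -oo, so phi is nondecreasing. Both phi and
    kappa - phi are nonnegative supersolutions, since 0 <= g <= kappa on [0, kappa]; the first fact
    gives phi' <= mu phi, the second phi < kappa through the strong maximum principle. *)
Lemma wave_of_front (g : R -> R) (kappa h c mu : R) (phi : R -> R) :
  HypH g kappa -> 0 < mu -> mu * mu - c * mu - 1 = 0 ->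
  front_profile g kappa h c phi ->
  exists d1 d2, wave g kappa (c * h) c mu phi d1 d2.
Proof.
  intros [Hg0 [_ [Hginc [Hkap [Hfix _]]]]] Hmu Hroot
    [[d1 [d2 [Hd1 [Hd2 [_ Heq]]]]] [Hpos [_ [Hmono [Hleft Hright]]]]].
  assert (Hinc : forall s t, s <= t -> phi s <= phi t).
  { destruct Hmono as [|Hdec]; [assumption|exfalso].
    destruct (Hleft (phi 0) (Hpos 0)) as [A HA].
    specialize (HA (Rmin A 0) (Rmin_l _ _)).
    specialize (Hdec (Rmin A 0) 0 (Rmin_r _ _)).
    rewrite Rabs_pos_eq in HA; [lra|left; apply Hpos]. }
  assert (Hd1' : forall s, is_derive phi s (d1 s)) by (intros; apply is_derive_Reals; auto).
  assert (Hd2' : forall s, is_derive d1 s (d2 s)) by (intros; apply is_derive_Reals; auto).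
  assert (Hle : forall s, phi s <= kappa).
  { intros s. apply Rnot_lt_le. intros Hlt.
    destruct (Hright (phi s - kappa) ltac:(lra)) as [A HA].
    specialize (HA (Rmax A s) (Rmax_l _ _)). apply Rabs_def2 in HA.
    specialize (Hinc s (Rmax A s) (Rmax_r _ _)). lra. }
  assert (Hgm : forall x y, 0 <= x -> x <= y -> g x <= g y).
  { intros x y Hx [Hxy | ->]; [left; apply Hginc; auto|lra]. }
  assert (Hgk : g kappa = kappa) by (apply Hfix; [lra|auto]).
  exists d1, d2. constructor; auto.
  - intros s. destruct (Hle s) as [|He]; [assumption|exfalso].
    assert (Hz : forall t, kappa - phi t = 0).
    { apply (supersolution_eq_zero c mu (fun t => kappa - phi t) (fun t => - d1 t)
               (fun t => - d2 t) s); auto.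
      - intros t. derive. ring.
      - intros t. derive. ring.
      - intros t. specialize (Hle t). lra.
      - intros t. specialize (Heq t).
        specialize (Hgm (phi (t - c * h)) kappa (Rlt_le _ _ (Hpos _)) (Hle _)). lra.
      - lra. }
    destruct (Hleft kappa Hkap) as [A HA]. specialize (HA A (Rle_refl _)).
    specialize (Hz A). apply Rabs_def2 in HA. lra.
  - intros s. apply (deriv_nonneg_of_monotone phi s); auto.
  - apply (supersolution_deriv_le c mu phi d1 d2); auto.
    + intros s. left; apply Hpos.
    + intros s. specialize (Heq s). specialize (Hg0 (phi (s - c * h)) (Rlt_le _ _ (Hpos _))). lra.
  - intros e He. destruct (Hleft e He) as [A HA]. exists A. intros s Hs.
    specialize (HA s Hs). apply Rabs_def2 in HA. lra.
  - intros e He. destruct (Hright e He) as [A HA]. exists A. intros s Hs.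
    specialize (HA s Hs). apply Rabs_def2 in HA. lra.
Qed.

Lemma wave_monotone g kappa tau c mu phi d1 d2 :
  wave g kappa tau c mu phi d1 d2 -> forall s t, s <= t -> phi s <= phi t.
Proof.
  intros Hw s t Hst. apply (le_of_deriv_nonneg phi d1); auto; intros; apply Hw.
Qed.

(** Integrated form of phi' <= mu phi: moving left by a bounded distance costs at most a fixed
    factor. *)
Lemma wave_harnack g kappa tau c mu phi d1 d2 :
  wave g kappa tau c mu phi d1 d2 ->
  forall s t, s <= t -> phi t * exp (mu * s) <= phi s * exp (mu * t).
Proof.
  intros Hw s t Hst.
  assert (- (exp (- mu * s) * phi s) <= - (exp (- mu * t) * phi t)).
  { pose proof (wave_deriv _ _ _ _ _ _ _ _ Hw).
    apply (le_of_deriv_nonneg (fun s => - (exp (- mu * s) * phi s))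
      (fun s => exp (- mu * s) * (mu * phi s - d1 s))); [assumption| |].
    - intros x _. derive. ring.
    - intros x _. pose proof (exp_pos (- mu * x)).
      pose proof (wave_deriv_le _ _ _ _ _ _ _ _ Hw x). apply Rmult_le_pos; lra. }
  assert (Hs : exp (mu * s) * exp (- mu * s) = 1)
    by (rewrite <- exp_plus, <- exp_0; f_equal; ring).
  assert (Ht : exp (mu * t) * exp (- mu * t) = 1)
    by (rewrite <- exp_plus, <- exp_0; f_equal; ring).
  replace (phi t * exp (mu * s)) with
    (exp (mu * s) * exp (mu * t) * (exp (- mu * t) * phi t))
    by (transitivity (exp (mu * t) * exp (- mu * t) * (phi t * exp (mu * s))); [ring|rewrite Ht; ring]).
  replace (phi s * exp (mu * t)) with
    (exp (mu * s) * exp (mu * t) * (exp (- mu * s) * phi s))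
    by (transitivity (exp (mu * s) * exp (- mu * s) * (phi s * exp (mu * t))); [ring|rewrite Hs; ring]).
  apply Rmult_le_compat_l; [|lra].
  pose proof (exp_pos (mu * s)). pose proof (exp_pos (mu * t)). nra.
Qed.

(* [y s = exp (- l s) phi s] solves [y'' + (2 l - c) y' + chi y + B (y(s - tau) - y) = - rho]
   with [B = g0 exp (- l tau)]; everything but [chi y] and [rho] is an exact derivative. *)
Lemma wave_flux_deriv g kappa tau c mu phi d1 d2 g0 l Y s :
  wave g kappa tau c mu phi d1 d2 ->
  (forall s, is_derive Y s (exp (- l * s) * phi s)) ->
  is_derive (fun s => exp (- l * s) * (d1 s + (l - c) * phi s)
                      - g0 * exp (- (l * tau)) * (Y s - Y (s - tau))) s
    (- (chi g0 tau c l * (exp (- l * s) * phi s))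
     - exp (- l * s) * (g (phi (s - tau)) - g0 * phi (s - tau))).
Proof.
  intros Hw HY.
  pose proof (wave_deriv _ _ _ _ _ _ _ _ Hw). pose proof (wave_deriv2 _ _ _ _ _ _ _ _ Hw).
  pose proof (wave_eq _ _ _ _ _ _ _ _ Hw s) as Heq.
  derive.
  replace (g (phi (s - tau))) with (phi s + c * d1 s - d2 s) by lra.
  replace (exp (- l * s)) with (exp (- (l * tau)) * exp (- l * (s + - tau)))
    by (rewrite <- exp_plus; f_equal; ring).
  unfold chi, Rminus. ring.
Qed.

(** Each term of the flux is controlled by y(s) = e^{-l s} phi(s): 0 <= phi' <= mu phi, and the
    integral of y over [s - tau, s] is at most tau e^{l tau} y(s), whose exponential the coefficient
    e^{-l tau} cancels. *)
Lemma wave_flux_le g kappa tau c mu phi d1 d2 g0 l Y s :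
  wave g kappa tau c mu phi d1 d2 -> 0 < c -> 0 < tau -> 0 < g0 -> 0 <= l <= mu ->
  (forall s, is_derive Y s (exp (- l * s) * phi s)) ->
  Rabs (exp (- l * s) * (d1 s + (l - c) * phi s)
        - g0 * exp (- (l * tau)) * (Y s - Y (s - tau)))
  <= (2 * mu + c + g0 * tau) * (exp (- l * s) * phi s).
Proof.
  intros Hw Hc Htau Hg0 Hl HY.
  pose proof (wave_deriv_nonneg _ _ _ _ _ _ _ _ Hw s).
  pose proof (wave_deriv_le _ _ _ _ _ _ _ _ Hw s).
  pose proof (wave_pos _ _ _ _ _ _ _ _ Hw s) as Hp.
  destruct (mvt_deriv Y _ (s - tau) s ltac:(lra) (fun x _ => HY x)) as [x [Hx He]].
  rewrite He. pose proof (exp_pos (- l * s)) as HE.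
  assert (H1 : Rabs (exp (- l * s) * (d1 s + (l - c) * phi s)) <= (2 * mu + c) * (exp (- l * s) * phi s)).
  { rewrite Rabs_mult, Rabs_pos_eq by lra.
    rewrite <- Rmult_assoc, (Rmult_comm (2 * mu + c)), Rmult_assoc.
    apply Rmult_le_compat_l; [lra|]. apply Rabs_le_between.
    assert (0 <= l * phi s <= mu * phi s) by (split; nra).
    assert (0 <= c * phi s) by nra. split; lra. }
  assert (H2 : 0 <= g0 * exp (- (l * tau)) * (exp (- l * x) * phi x * (s - (s - tau)))
          <= g0 * tau * (exp (- l * s) * phi s)).
  { pose proof (wave_pos _ _ _ _ _ _ _ _ Hw x) as Hpx.
    pose proof (wave_monotone _ _ _ _ _ _ _ _ Hw x s ltac:(lra)) as Hm.
    replace (g0 * exp (- (l * tau)) * (exp (- l * x) * phi x * (s - (s - tau))))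
      with (g0 * tau * (exp (- (l * tau) + - l * x) * phi x))
      by (rewrite exp_plus; ring).
    assert (0 < g0 * tau) by (apply Rmult_lt_0_compat; lra).
    pose proof (exp_pos (- (l * tau) + - l * x)).
    split; [apply Rmult_le_pos; [lra|apply Rmult_le_pos; lra]|].
    apply Rmult_le_compat_l; [lra|].
    apply Rmult_le_compat; try lra. apply exp_le_exp. nra. }
  unfold Rminus at 1. eapply Rle_trans; [apply Rabs_triang|].
  rewrite Rabs_Ropp, (Rabs_pos_eq (g0 * _ * _)) by lra. lra.
Qed.

(** The flux vanishes at -oo together with y, while its derivative keeps one sign and has size at
    least delta y / 2 once the nonlinear remainder is absorbed. The resulting bound of int y by y(s)
    is a Gronwall inequality for the integral; Harnack then passes from integrals over unit
    intervals to y. The gain depends on delta but not on l. *)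
Lemma wave_decay_gain g kappa tau c mu phi d1 d2 g0 l delta :
  wave g kappa tau c mu phi d1 d2 -> 0 < c -> 0 < tau -> 0 < g0 -> 0 < mu ->
  linear_at_zero g g0 -> 0 <= l <= mu ->
  (forall e, 0 < e -> exists S, forall s, s <= S -> exp (- l * s) * phi s <= e) ->
  0 < delta -> delta <= Rabs (chi g0 tau c l) ->
  decays phi (l + delta / (2 * (2 * mu + c + g0 * tau))).
Proof.
  intros Hw Hc Htau Hg0 Hmu Hlin Hl Hy Hdelta Hchi.
  pose proof (wave_deriv _ _ _ _ _ _ _ _ Hw) as Hd.
  pose proof (wave_pos _ _ _ _ _ _ _ _ Hw) as Hpos.
  set (k := 2 * mu + c + g0 * tau).
  assert (Hk : 0 < k).
  { unfold k. assert (0 < g0 * tau) by (apply Rmult_lt_0_compat; lra). lra. }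
  set (kap := delta / (2 * k)).
  assert (Hkap : 0 < kap) by (unfold kap; apply Rdiv_lt_0_compat; lra).
  set (y := fun s => exp (- l * s) * phi s).
  assert (Hy0 : forall s, 0 < y s).
  { intros s. apply Rmult_lt_0_compat; [apply exp_pos|apply Hpos]. }
  destruct (ex_antiderivative y) as [Y HY].
  { intros x. apply (ex_derive_continuous y). unfold y. auto_derive. eexists; eauto. }
  set (E := fun s => exp (- l * s) * (d1 s + (l - c) * phi s)
                      - g0 * exp (- (l * tau)) * (Y s - Y (s - tau))).
  set (r := fun s => exp (- l * s) * (g (phi (s - tau)) - g0 * phi (s - tau))).
  assert (HE : forall s, is_derive E s (- (chi g0 tau c l * y s) - r s)).
  { intros s. apply (wave_flux_deriv g kappa tau c mu phi d1 d2); auto. }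
  assert (HEle : forall s, Rabs (E s) <= k * y s).
  { intros s. apply (wave_flux_le g kappa tau c mu phi d1 d2); auto. }
  destruct (Hlin (delta / 2) ltac:(lra)) as [u0 [Hu0 Hlin']].
  destruct (wave_left _ _ _ _ _ _ _ _ Hw u0 Hu0) as [S HS].
  assert (Hr : forall s, s <= S -> Rabs (r s) <= delta / 2 * y s).
  { intros s Hs. unfold r, y. rewrite Rabs_mult, (Rabs_pos_eq (exp _)) by (left; apply exp_pos).
    replace (delta / 2 * (exp (- l * s) * phi s)) with (exp (- l * s) * (delta / 2 * phi s)) by ring.
    apply Rmult_le_compat_l; [left; apply exp_pos|].
    pose proof (wave_monotone _ _ _ _ _ _ _ _ Hw (s - tau) s ltac:(lra)).
    eapply Rle_trans; [apply Hlin'; split; [apply Hpos|apply HS; lra]|].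
    apply Rmult_le_compat_l; lra. }
  assert (HYm : forall s t, s <= t -> Y s <= Y t).
  { intros s t Hst. apply (le_of_deriv_nonneg Y y); auto. intros x _. left; apply Hy0. }
  assert (H1 : forall t s, t <= s -> s <= S -> delta / 2 * (Y s - Y t) <= Rabs (E s - E t)).
  { intros t s Hts Hs. destruct (Rle_dec 0 (chi g0 tau c l)) as [Hch|Hch].
    - rewrite Rabs_pos_eq in Hchi by lra.
      assert (- (E t + delta / 2 * Y t) <= - (E s + delta / 2 * Y s)).
      { apply (le_of_deriv_nonneg (fun s => - (E s + delta / 2 * Y s))
          (fun s => - (- (chi g0 tau c l * y s) - r s + delta / 2 * y s))); [lra| |].
        - intros x _. derive. ring.
        - intros x Hx. specialize (Hr x ltac:(lra)). apply Rabs_le_between in Hr.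
          specialize (Hy0 x). nra. }
      pose proof (Rle_abs (- (E s - E t))) as HA. rewrite Rabs_Ropp in HA. lra.
    - rewrite Rabs_left in Hchi by lra.
      assert (E t - delta / 2 * Y t <= E s - delta / 2 * Y s).
      { apply (le_of_deriv_nonneg (fun s => E s - delta / 2 * Y s)
          (fun s => - (chi g0 tau c l * y s) - r s - delta / 2 * y s)); [lra| |].
        - intros x _. derive. ring.
        - intros x Hx. specialize (Hr x ltac:(lra)). apply Rabs_le_between in Hr.
          specialize (Hy0 x). nra. }
      pose proof (Rle_abs (E s - E t)). lra. }
  assert (H2 : forall t s, t <= s -> s <= S -> kap * (Y s - Y t) <= y s).
  { intros t s Hts Hs.
    assert (delta / 2 * (Y s - Y t) <= k * y s).
    { apply Rle_plus_epsilon. intros e He.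
      destruct (Hy (e / k)) as [S' HS']; [apply Rdiv_lt_0_compat; lra|].
      set (t' := Rmin t S').
      assert (Ht1 : t' <= t) by apply Rmin_l.
      assert (Ht2 : t' <= S') by apply Rmin_r.
      specialize (H1 t' s ltac:(lra) Hs). specialize (HYm t' t Ht1).
      specialize (HS' t' Ht2). fold (y t') in HS'.
      assert (k * y t' <= k * (e / k)) by (apply Rmult_le_compat_l; lra).
      replace (k * (e / k)) with e in H by (field; lra).
      pose proof (HEle s). pose proof (HEle t').
      assert (Rabs (E s - E t') <= Rabs (E s) + Rabs (E t')).
      { unfold Rminus. eapply Rle_trans; [apply Rabs_triang|]. rewrite Rabs_Ropp. lra. }
      assert (delta / 2 * (Y s - Y t) <= delta / 2 * (Y s - Y t')) by (apply Rmult_le_compat_l; lra).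
      lra. }
    apply Rmult_le_reg_l with k; [assumption|].
    replace (k * (kap * (Y s - Y t))) with (delta / 2 * (Y s - Y t)) by (unfold kap; field; lra).
    assumption. }
  assert (H3 : forall t s, t <= s -> s <= S ->
            kap * (Y s - Y t) <= y S * exp (kap * (s - S))).
  { intros t s Hts Hs.
    assert ((Y s - Y t) * exp (- kap * s) <= (Y S - Y t) * exp (- kap * S)).
    { apply (le_of_deriv_nonneg (fun s => (Y s - Y t) * exp (- kap * s))
        (fun s => exp (- kap * s) * (y s - kap * (Y s - Y t)))); [lra| |].
      - intros x _. derive. ring.
      - intros x Hx. specialize (H2 t x ltac:(lra) ltac:(lra)).
        apply Rmult_le_pos; [left; apply exp_pos|lra]. }
    specialize (H2 t S ltac:(lra) ltac:(lra)).
    replace (kap * (Y s - Y t)) with (kap * ((Y s - Y t) * exp (- kap * s)) * exp (kap * s)).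
    - replace (y S * exp (kap * (s - S))) with (y S * exp (- kap * S) * exp (kap * s))
        by (rewrite Rmult_assoc, <- exp_plus; f_equal; f_equal; ring).
      apply Rmult_le_compat_r; [left; apply exp_pos|].
      pose proof (exp_pos (- kap * S)).
      apply Rle_trans with (kap * ((Y S - Y t) * exp (- kap * S))).
      + apply Rmult_le_compat_l; lra.
      + rewrite <- Rmult_assoc. apply Rmult_le_compat_r; lra.
    - transitivity (kap * (Y s - Y t) * exp (- kap * s + kap * s)); [rewrite exp_plus; ring|].
      replace (- kap * s + kap * s) with 0 by ring. rewrite exp_0. ring. }
  exists (exp mu * (y S / kap * exp (- kap * S))), S. intros s Hs.
  assert (H4 : exp (- mu) * y s <= Y s - Y (s - 1)).
  { destruct (mvt_deriv Y y (s - 1) s) as [x [Hx He]]; [lra|auto|].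
    rewrite He. replace (y x * (s - (s - 1))) with (y x) by ring.
    pose proof (wave_harnack _ _ _ _ _ _ _ _ Hw x s ltac:(lra)) as Hh.
    unfold y.
    assert (exp (- l * s) <= exp (- l * x)) by (apply exp_le_exp; nra).
    assert (exp (- mu) * phi s <= phi x).
    { apply Rmult_le_reg_r with (exp (mu * s)); [apply exp_pos|].
      eapply Rle_trans; [|apply Hh].
      replace (exp (- mu) * phi s * exp (mu * s)) with (phi s * exp (- mu + mu * s))
        by (rewrite exp_plus; ring).
      apply Rmult_le_compat_l; [left; apply Hpos|]. apply exp_le_exp. nra. }
    replace (exp (- mu) * (exp (- l * s) * phi s)) with (exp (- l * s) * (exp (- mu) * phi s)) by ring.
    apply Rmult_le_compat; try lra; [left; apply exp_pos|].
    apply Rmult_le_pos; left; [apply exp_pos|apply Hpos]. }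
  specialize (H3 (s - 1) s ltac:(lra) Hs).
  assert (H5 : y s <= exp mu * (y S / kap * exp (- kap * S)) * exp (kap * s)).
  { assert (Hem : exp mu * exp (- mu) = 1)
      by (rewrite <- exp_plus, <- exp_0; f_equal; ring).
    replace (y s) with (exp mu * (exp (- mu) * y s)) by (rewrite <- Rmult_assoc, Hem; ring).
    rewrite Rmult_assoc. apply Rmult_le_compat_l; [left; apply exp_pos|].
    apply Rle_trans with (Y s - Y (s - 1)); [assumption|].
    apply Rmult_le_reg_l with kap; [assumption|].
    eapply Rle_trans; [apply H3|].
    replace (kap * (y S / kap * exp (- kap * S) * exp (kap * s)))
      with (y S * (exp (- kap * S) * exp (kap * s))) by (field; lra).
    rewrite <- exp_plus. right. f_equal. f_equal. ring. }
  fold k. fold kap. rewrite Rmult_plus_distr_r, exp_plus.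
  replace (phi s) with (exp (l * s) * y s).
  - set (Q := exp mu * (y S / kap * exp (- kap * S))) in *.
    replace (Q * (exp (l * s) * exp (kap * s))) with (exp (l * s) * (Q * exp (kap * s))) by ring.
    apply Rmult_le_compat_l; [left; apply exp_pos|assumption].
  - unfold y. rewrite <- Rmult_assoc, <- exp_plus.
    replace (l * s + - l * s) with 0 by ring. rewrite exp_0. ring.
Qed.

Lemma exp_vanishes_at_minus_infinity (a K e : R) :
  0 < a -> 0 < e -> exists S, forall s, s <= S -> K * exp (a * s) <= e.
Proof.
  intros Ha He.
  assert (HK : 0 < Rabs K + 1) by (pose proof (Rabs_pos K); lra).
  exists (ln (e / (Rabs K + 1)) / a). intros s Hs.
  assert (Hs' : exp (a * s) <= e / (Rabs K + 1)).
  { rewrite <- (exp_ln (e / (Rabs K + 1))) by (apply Rdiv_lt_0_compat; lra).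
    apply exp_le_exp.
    replace (ln (e / (Rabs K + 1))) with (a * (ln (e / (Rabs K + 1)) / a)) by (field; lra).
    apply Rmult_le_compat_l; lra. }
  pose proof (exp_pos (a * s)) as HE. pose proof (Rle_abs K).
  apply Rle_trans with ((Rabs K + 1) * exp (a * s)).
  - apply Rmult_le_compat_r; lra.
  - replace e with ((Rabs K + 1) * (e / (Rabs K + 1))) by (field; lra).
    apply Rmult_le_compat_l; lra.
Qed.

Lemma decays_antitone (phi : R -> R) (l l' : R) :
  l' <= l -> decays phi l -> decays phi l'.
Proof.
  intros Hl [K [S HS]]. exists (Rabs K), (Rmin S 0). intros s Hs.
  assert (s <= S) by (eapply Rle_trans; [apply Hs|apply Rmin_l]).
  assert (s <= 0) by (eapply Rle_trans; [apply Hs|apply Rmin_r]).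
  eapply Rle_trans; [apply HS; assumption|].
  eapply Rle_trans; [apply Rmult_le_compat_r; [left; apply exp_pos|apply Rle_abs]|].
  apply Rmult_le_compat_l; [apply Rabs_pos|]. apply exp_le_exp. nra.
Qed.

Lemma weighted_vanishes (phi : R -> R) (l l' : R) :
  l < l' -> decays phi l' ->
  forall e, 0 < e -> exists S, forall s, s <= S -> exp (- l * s) * phi s <= e.
Proof.
  intros Hl [K [S HS]] e He.
  destruct (exp_vanishes_at_minus_infinity (l' - l) K e ltac:(lra) He) as [S' HS'].
  exists (Rmin S S'). intros s Hs.
  assert (s <= S) by (eapply Rle_trans; [apply Hs|apply Rmin_l]).
  assert (s <= S') by (eapply Rle_trans; [apply Hs|apply Rmin_r]).
  eapply Rle_trans; [|apply (HS' s); assumption].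
  replace ((l' - l) * s) with (- l * s + l' * s) by ring. rewrite exp_plus.
  replace (K * (exp (- l * s) * exp (l' * s))) with (exp (- l * s) * (K * exp (l' * s))) by ring.
  apply Rmult_le_compat_l; [left; apply exp_pos|auto].
Qed.

(** l is the supremum of all decay rates; Harnack bounds it by mu, and chi(0) = g0 - 1 > 0 makes it
    positive. Were chi(l) <> 0, |chi| would stay above some delta slightly to the left of l, and the
    gain, uniform in the starting rate, would lead from l - q past l. *)
Lemma wave_critical_rate g kappa tau c mu phi d1 d2 g0 :
  wave g kappa tau c mu phi d1 d2 -> 0 < c -> 0 < tau -> 1 < g0 -> 0 < mu ->
  linear_at_zero g g0 ->
  exists l, 0 < l /\ l <= mu /\ chi g0 tau c l = 0 /\
    (forall l', l' < l -> decays phi l') /\ (forall l', l < l' -> ~ decays phi l').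
Proof.
  intros Hw Hc Htau Hg0 Hmu Hlin.
  assert (Hbd : forall l, decays phi l -> l <= mu).
  { intros l Hl. apply Rnot_lt_le. intros Hlt.
    pose proof (wave_pos _ _ _ _ _ _ _ _ Hw 0) as H0.
    destruct (weighted_vanishes phi mu l Hlt Hl (phi 0 / 2) ltac:(lra)) as [S HS].
    specialize (HS (Rmin S 0) (Rmin_l _ _)).
    pose proof (wave_harnack _ _ _ _ _ _ _ _ Hw (Rmin S 0) 0 (Rmin_r _ _)) as Hh.
    set (s := Rmin S 0) in *. rewrite Rmult_0_r, exp_0 in Hh.
    assert (He : exp (- mu * s) * exp (mu * s) = 1)
      by (rewrite <- exp_plus, <- exp_0; f_equal; ring).
    assert (exp (- mu * s) * (phi 0 * exp (mu * s)) <= exp (- mu * s) * (phi s * 1)).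
    { apply Rmult_le_compat_l; [left; apply exp_pos|assumption]. }
    replace (exp (- mu * s) * (phi 0 * exp (mu * s))) with (phi 0) in H; [lra|].
    transitivity (phi 0 * (exp (- mu * s) * exp (mu * s))); [rewrite He; ring|ring]. }
  destruct (completeness (fun l => decays phi l)) as [l [Hub Hlub]].
  - exists mu. intros l. apply Hbd.
  - exists 0, kappa, 0. intros s _. rewrite Rmult_0_l, exp_0, Rmult_1_r.
    left. apply (wave_lt _ _ _ _ _ _ _ _ Hw).
  - assert (Hbelow : forall l', l' < l -> decays phi l').
    { intros l' Hl'. apply NNPP. intros Hn.
      assert (l <= l'); [|lra]. apply Hlub. intros z Hz. apply Rnot_lt_le. intros Hlt.
      apply Hn. apply (decays_antitone phi z); [lra|assumption]. }
    assert (Habove : forall l', l < l' -> ~ decays phi l').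
    { intros l' Hl' Hd. specialize (Hub l' Hd). lra. }
    set (k := 2 * mu + c + g0 * tau).
    assert (Hk : 0 < k).
    { unfold k. assert (0 < g0 * tau) by (apply Rmult_lt_0_compat; lra). lra. }
    assert (Hl0 : 0 < l).
    { assert (Hd : decays phi (0 + (g0 - 1) / (2 * k))).
      { apply (wave_decay_gain g kappa tau c mu phi d1 d2); auto; try lra.
        - intros e He. destruct (wave_left _ _ _ _ _ _ _ _ Hw e He) as [A HA].
          exists A. intros s Hs. specialize (HA s Hs).
          rewrite Ropp_0, Rmult_0_l, exp_0. lra.
        - unfold chi. rewrite (Rmult_0_l tau), Ropp_0, exp_0.
          replace (0 * 0 - c * 0 - 1 + g0 * 1) with (g0 - 1) by ring. apply Rle_abs. }
      specialize (Hub _ Hd).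
      assert (0 < (g0 - 1) / (2 * k)) by (apply Rdiv_lt_0_compat; lra). lra. }
    assert (Hlmu : l <= mu) by (apply Hlub; intros z; apply Hbd).
    exists l. repeat split; auto.
    apply NNPP. intros Hchi.
    set (delta := Rabs (chi g0 tau c l) / 2).
    assert (Hdelta : 0 < delta).
    { unfold delta. apply Rabs_pos_lt in Hchi. lra. }
    assert (Hcont : continuous (chi g0 tau c) l).
    { apply (ex_derive_continuous (chi g0 tau c)). unfold chi. auto_derive. trivial. }
    apply continuity_pt_filterlim in Hcont.
    destruct (Hcont delta Hdelta) as [r [Hr Hcr]].
    set (kap := delta / (2 * k)).
    assert (Hkap : 0 < kap) by (unfold kap; apply Rdiv_lt_0_compat; lra).
    (* Below r to stay where |chi| >= delta, below kap so that the gain passes l, below l so that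
       the starting rate is positive. *)
    set (q := Rmin r (Rmin kap l) / 2).
    assert (Hq : 0 < q < r /\ q < kap /\ q < l).
    { unfold q. pose proof (Rmin_l r (Rmin kap l)). pose proof (Rmin_r r (Rmin kap l)).
      pose proof (Rmin_l kap l). pose proof (Rmin_r kap l).
      assert (0 < Rmin r (Rmin kap l)) by (repeat apply Rmin_glb_lt; lra). lra. }
    apply (Habove (l - q + kap)); [lra|].
    apply (wave_decay_gain g kappa tau c mu phi d1 d2 g0); auto; try lra.
    + apply (weighted_vanishes phi (l - q) (l - q / 2)); [lra|]. apply Hbelow. lra.
    + specialize (Hcr (l - q)). unfold R_dist in Hcr. simpl in Hcr. unfold Rdist in Hcr.
      assert (Hx : Rabs (chi g0 tau c (l - q) - chi g0 tau c l) < delta).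
      { apply Hcr. split.
        - split; [exact I|lra].
        - replace (l - q - l) with (- q) by ring. rewrite Rabs_Ropp, Rabs_pos_eq; lra. }
      rewrite Rabs_minus_sym in Hx.
      pose proof (Rabs_triang_inv (chi g0 tau c l) (chi g0 tau c (l - q))).
      unfold delta in *. lra.
Qed.

(** * Leading behaviour of profiles at -oo *)

(** [true] encodes the extra factor that a double root of chi allows; the sign makes it positive
    near -oo. *)
Definition prefactor (b : bool) (s : R) : R := if b then - s else 1.

Definition has_asymptotics (phi : R -> R) (l A : R) (b : bool) : Prop :=
  forall e, 0 < e -> exists S, forall s, s <= S ->
    Rabs (exp (- l * s) * phi s - A * prefactor b s) <= e * prefactor b s.

Lemma has_asymptotics_const (phi : R -> R) (l A M e' S : R) :
  0 < e' -> (forall s, s <= S -> Rabs (exp (- l * s) * phi s - A) <= M * exp (e' * s)) ->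
  has_asymptotics phi l A false.
Proof.
  intros He' HM e He.
  destruct (exp_vanishes_at_minus_infinity e' M e He' He) as [S' HS'].
  exists (Rmin S S'). intros s Hs. unfold prefactor. rewrite !Rmult_1_r.
  eapply Rle_trans; [apply HM|apply HS'];
    (eapply Rle_trans; [apply Hs|]); [apply Rmin_l|apply Rmin_r].
Qed.

Lemma decays_of_weighted (phi : R -> R) (l M e' S : R) :
  (forall s, s <= S -> exp (- l * s) * phi s <= M * exp (e' * s)) -> decays phi (l + e').
Proof.
  intros HM. exists M, S. intros s Hs. specialize (HM s Hs).
  rewrite Rmult_plus_distr_r, exp_plus.
  replace (phi s) with (exp (l * s) * (exp (- l * s) * phi s)).
  - replace (M * (exp (l * s) * exp (e' * s))) with (exp (l * s) * (M * exp (e' * s))) by ring.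
    apply Rmult_le_compat_l; [left; apply exp_pos|assumption].
  - rewrite <- Rmult_assoc, <- exp_plus.
    replace (l * s + - l * s) with 0 by ring. rewrite exp_0. ring.
Qed.

(** The Hoelder bound makes the remainder O(v^{1 + theta}) with v = phi(s - tau) <= phi(s), so
    division by e^{l s} leaves roughly e^{theta l s}. Half of that rate is claimed, because phi is
    only known to decay at rates strictly below l. *)
Lemma wave_remainder_decay g kappa tau c mu phi d1 d2 g0 l C theta delta :
  wave g kappa tau c mu phi d1 d2 -> 0 < tau -> 0 < C -> 0 < theta <= 1 -> 0 < delta ->
  (forall u, 0 < u <= delta -> Rabs (g u / u - g0) <= C * Rpower u theta) ->
  0 < l -> (forall l', l' < l -> decays phi l') ->
  exists C' S, S <= 0 /\ forall s, s <= S ->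
    Rabs (exp (- l * s) * (g (phi (s - tau)) - g0 * phi (s - tau))) <= C' * exp (theta * l / 2 * s).
Proof.
  intros Hw Htau HC Hth Hdelta Hh Hl Hdec.
  pose proof (wave_pos _ _ _ _ _ _ _ _ Hw) as Hpos.
  assert (Htl : 0 < theta * l) by (apply Rmult_lt_0_compat; lra).
  (* The loss in the exponent is (1 + theta) eta <= theta l / 2, as theta <= 1. *)
  set (eta := theta * l / 4).
  destruct (Hdec (l - eta) ltac:(unfold eta; lra)) as [K [S1 HK]].
  destruct (wave_left _ _ _ _ _ _ _ _ Hw delta Hdelta) as [S2 HS2].
  assert (HK0 : 0 < K).
  { specialize (HK S1 (Rle_refl _)). specialize (Hpos S1).
    pose proof (exp_pos ((l - eta) * S1)). nra. }
  exists (C * (K * Rpower K theta)), (Rmin 0 (Rmin S1 S2)).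
  split; [apply Rmin_l|]. intros s Hs.
  pose proof (Rmin_l 0 (Rmin S1 S2)). pose proof (Rmin_r 0 (Rmin S1 S2)).
  pose proof (Rmin_l S1 S2). pose proof (Rmin_r S1 S2).
  set (v := phi (s - tau)).
  assert (Hv : 0 < v) by apply Hpos.
  assert (Hvs : v <= phi s) by (apply (wave_monotone _ _ _ _ _ _ _ _ Hw); lra).
  assert (Hvd : v < delta) by (apply HS2; lra).
  assert (Hvk : v <= K * exp ((l - eta) * s)).
  { eapply Rle_trans; [apply Hvs|]. apply HK; lra. }
  assert (Hg : Rabs (g v - g0 * v) <= C * (v * Rpower v theta)).
  { replace (g v - g0 * v) with (v * (g v / v - g0)) by (field; lra).
    rewrite Rabs_mult, Rabs_pos_eq by lra. specialize (Hh v ltac:(lra)).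
    replace (C * (v * Rpower v theta)) with (v * (C * Rpower v theta)) by ring.
    apply Rmult_le_compat_l; lra. }
  assert (Hpw : Rpower v theta <= Rpower K theta * exp (theta * ((l - eta) * s))).
  { unfold Rpower. rewrite <- exp_plus. apply exp_le_exp.
    rewrite <- Rmult_plus_distr_l. apply Rmult_le_compat_l; [lra|].
    rewrite <- (ln_exp ((l - eta) * s)) at 1. rewrite <- ln_mult by (auto; apply exp_pos).
    destruct Hvk as [Hvk | ->]; [left; apply ln_increasing; lra|lra]. }
  rewrite Rabs_mult, (Rabs_pos_eq (exp _)) by (left; apply exp_pos).
  apply Rle_trans with (exp (- l * s) * (C * ((K * exp ((l - eta) * s)) *
     (Rpower K theta * exp (theta * ((l - eta) * s)))))).
  - apply Rmult_le_compat_l; [left; apply exp_pos|].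
    eapply Rle_trans; [apply Hg|]. apply Rmult_le_compat_l; [lra|].
    apply Rmult_le_compat; try lra. left; unfold Rpower; apply exp_pos.
  - replace (exp (- l * s) * (C * ((K * exp ((l - eta) * s)) *
     (Rpower K theta * exp (theta * ((l - eta) * s)))))) with
     (C * (K * Rpower K theta) * (exp (- l * s) * exp ((l - eta) * s) * exp (theta * ((l - eta) * s))))
     by ring.
    rewrite <- !exp_plus. apply Rmult_le_compat_l.
    + apply Rmult_le_pos; [lra|]. apply Rmult_le_pos; [lra|].
      left; unfold Rpower; apply exp_pos.
    + apply exp_le_exp. unfold eta.
      replace (- l * s + (l - theta * l / 4) * s + theta * ((l - theta * l / 4) * s))
        with (theta * l * s * (3 / 4 - theta / 4)) by field.
      replace (theta * l / 2 * s) with (theta * l * s * (1 / 2)) by field.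
      assert (theta * l * s <= 0) by nra. nra.
Qed.

(** The subexponential growth demanded by the Lyapunov argument holds because phi decays at every
    rate below l. The sign of the coefficient comes from the failure of all rates above l, or, when
    y is asymptotically linear, from y > 0. *)
Lemma wave_asymptotics g kappa tau c mu phi d1 d2 g0 C theta delta :
  wave g kappa tau c mu phi d1 d2 -> 0 < c -> 0 < tau -> 1 < g0 -> 0 < mu ->
  linear_at_zero g g0 -> 0 < C -> 0 < theta <= 1 -> 0 < delta ->
  (forall u, 0 < u <= delta -> Rabs (g u / u - g0) <= C * Rpower u theta) ->
  exists l A b, 0 < l /\ 0 < A /\ has_asymptotics phi l A b.
Proof.
  intros Hw Hc Htau Hg0 Hmu Hlin HC Hth Hdelta Hh.
  destruct (wave_critical_rate g kappa tau c mu phi d1 d2 g0)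
    as [l [Hl [Hlmu [Hchi [Hbelow Habove]]]]]; auto.
  destruct (wave_remainder_decay g kappa tau c mu phi d1 d2 g0 l C theta delta)
    as [C' [S [HS HCr]]]; auto.
  pose proof (wave_deriv _ _ _ _ _ _ _ _ Hw) as Hd.
  pose proof (wave_deriv2 _ _ _ _ _ _ _ _ Hw) as Hd2.
  pose proof (wave_pos _ _ _ _ _ _ _ _ Hw) as Hpos.
  set (eps := theta * l / 2) in *.
  assert (Heps : 0 < eps).
  { unfold eps. assert (0 < theta * l) by (apply Rmult_lt_0_compat; lra). lra. }
  set (y := fun s => exp (- l * s) * phi s).
  assert (Hy0 : forall s, 0 < y s).
  { intros s. apply Rmult_lt_0_compat; [apply exp_pos|apply Hpos]. }
  destruct (ex_antiderivative y) as [Y HY].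
  { intros x. apply (ex_derive_continuous y). unfold y. auto_derive. eexists; eauto. }
  set (B := g0 * exp (- (l * tau))).
  assert (HB : 0 < B) by (unfold B; apply Rmult_lt_0_compat; [lra|apply exp_pos]).
  set (E := fun s => exp (- l * s) * (d1 s + (l - c) * phi s) - B * (Y s - Y (s - tau))).
  destruct (limit_of_exp_deriv E (fun s => - (chi g0 tau c l * y s) -
      exp (- l * s) * (g (phi (s - tau)) - g0 * phi (s - tau))) S C' eps) as [E0 HE0]; auto.
  { intros s _. apply (wave_flux_deriv g kappa tau c mu phi d1 d2); auto. }
  { intros s Hs. rewrite Hchi, Rmult_0_l, Ropp_0, Rminus_0_l, Rabs_Ropp. auto. }
  set (u := fun s => exp (- l * s) * (d1 s - l * phi s)).
  assert (Hyu : forall s, is_derive y s (u s)).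
  { intros s. unfold y, u. derive. ring. }
  assert (Huc : forall s, continuous u s).
  { intros s. apply (ex_derive_continuous u). unfold u. auto_derive.
    repeat split; eexists; eauto. }
  set (m := 2 * l - c - B * tau).
  assert (HEm : forall s, u s + m * y s + B * (tau * y s - (Y s - Y (s - tau))) = E s).
  { intros s. unfold u, m, E, y. ring. }
  assert (Hysub : forall eta, 0 < eta -> exists M S', forall s, s <= S' -> y s <= M * exp (- eta * s)).
  { intros eta Heta. destruct (Hbelow (l - eta) ltac:(lra)) as [M [S' HM]].
    exists M, S'. intros s Hs. specialize (HM s Hs). unfold y.
    replace (- eta * s) with (- l * s + (l - eta) * s) by ring. rewrite exp_plus.
    replace (M * (exp (- l * s) * exp ((l - eta) * s)))
      with (exp (- l * s) * (M * exp ((l - eta) * s))) by ring.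
    apply Rmult_le_compat_l; [left; apply exp_pos|assumption]. }
  assert (Hfinal : forall A M e', 0 < e' ->
     (forall s, s <= S -> Rabs (y s - A) <= M * exp (e' * s)) ->
     0 < A /\ has_asymptotics phi l A false).
  { intros A M e' He' HM. split; [|apply (has_asymptotics_const phi l A M e' S); auto].
    apply Rnot_le_lt. intros HA. apply (Habove (l + e')); [lra|].
    apply (decays_of_weighted phi l M e' S). intros s Hs. specialize (HM s Hs).
    apply Rabs_le_between in HM. fold (y s). lra. }
  destruct (Req_dec m 0) as [Hm | Hm].
  - (* Double characteristic root: [a * s] is the particular solution with flux [E0]. *)
    set (a := E0 / (1 + B * (tau * tau) / 2)).
    assert (HBtt : 0 < B * (tau * tau)).
    { apply Rmult_lt_0_compat; [lra|]. apply Rmult_lt_0_compat; lra. }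
    assert (Ha : a * (1 + B * (tau * tau) / 2) = E0) by (unfold a; field; lra).
    destruct (delay_solution_converges tau B m eps S (C' / eps)
      (fun s => y s - a * s) (fun s => u s - a) (fun s => Y s - a * (s * s) / 2)
      (fun s => E s - E0)) as [p0 [M [e' [He' [_ HM]]]]]; auto.
    + intros s. derive. field.
    + intros s. derive. ring.
    + intros s. apply (continuous_minus u (fun _ => a)); [apply Huc|apply continuous_const].
    + intros s _. rewrite <- Ha, <- HEm, Hm. field.
    + intros eta Heta. destruct (Hysub eta Heta) as [M [S' HM]].
      exists (M + Rabs a / eta), (Rmin S' 0). intros s Hs.
      assert (Hs1 : s <= S') by (eapply Rle_trans; [apply Hs|apply Rmin_l]).
      assert (Hs2 : s <= 0) by (eapply Rle_trans; [apply Hs|apply Rmin_r]).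
      specialize (HM s Hs1). specialize (Hy0 s).
      unfold Rminus. eapply Rle_trans; [apply Rabs_triang|].
      rewrite Rabs_Ropp, Rabs_mult, (Rabs_pos_eq (y s)) by lra.
      rewrite (Rabs_left1 s) by lra.
      assert (- s <= / eta * exp (- eta * s)).
      { apply Rmult_le_reg_l with eta; [assumption|].
        rewrite <- Rmult_assoc, Rinv_r, Rmult_1_l by lra.
        pose proof (exp_ineq1_le (- eta * s)). lra. }
      assert (Rabs a * - s <= Rabs a * (/ eta * exp (- eta * s)))
        by (apply Rmult_le_compat_l; [apply Rabs_pos|assumption]).
      unfold Rdiv. lra.
    + assert (Hup : forall s, s <= S -> Rabs (y s - a * s) <= Rabs p0 + Rabs M).
      { intros s Hs. specialize (HM s Hs).
        replace (y s - a * s) with (p0 + (y s - a * s - p0)) by ring.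
        eapply Rle_trans; [apply Rabs_triang|]. apply Rplus_le_compat_l.
        eapply Rle_trans; [apply HM|].
        eapply Rle_trans; [apply Rmult_le_compat_r; [left; apply exp_pos|apply Rle_abs]|].
        rewrite <- (Rmult_1_r (Rabs M)) at 2. apply Rmult_le_compat_l; [apply Rabs_pos|].
        rewrite <- exp_0. apply exp_le_exp. nra. }
      set (N := Rabs p0 + Rabs M) in *.
      assert (HN : 0 <= N) by (unfold N; pose proof (Rabs_pos p0); pose proof (Rabs_pos M); lra).
      destruct (Rtotal_order a 0) as [Ha0 | [Ha0 | Ha0]].
      * exists l, (- a), true. split; [assumption|split; [lra|]].
        intros e He. exists (Rmin S (- (N / e))). intros s Hs.
        assert (Hs1 : s <= S) by (eapply Rle_trans; [apply Hs|apply Rmin_l]).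
        assert (Hs2 : s <= - (N / e)) by (eapply Rle_trans; [apply Hs|apply Rmin_r]).
        unfold prefactor. fold (y s). specialize (Hup s Hs1).
        replace (y s - - a * - s) with (y s - a * s) by ring.
        apply Rle_trans with N; [assumption|].
        replace N with (e * (N / e)) by (field; lra). apply Rmult_le_compat_l; lra.
      * exists l, p0, false. split; [assumption|].
        apply (Hfinal p0 M e'); auto. intros s Hs. specialize (HM s Hs).
        rewrite Ha0, Rmult_0_l, Rminus_0_r in HM. assumption.
      (* Here y would stay at bounded distance from a s, which tends to -oo on the left. *)
      * exfalso. set (s := Rmin S (- ((N + 1) / a))).
        assert (Hs1 : s <= S) by apply Rmin_l.
        assert (Hs2 : s <= - ((N + 1) / a)) by apply Rmin_r.
        specialize (Hup s Hs1). apply Rabs_le_between in Hup. specialize (Hy0 s).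
        assert (a * s <= a * - ((N + 1) / a)) by (apply Rmult_le_compat_l; lra).
        replace (a * - ((N + 1) / a)) with (- (N + 1)) in H by (field; lra). lra.
  (* Simple root: the constant [a] is the particular solution with flux [E0]. *)
  - set (a := E0 / m).
    assert (Ha : m * a = E0) by (unfold a; field; lra).
    destruct (delay_solution_converges tau B m eps S (C' / eps)
      (fun s => y s - a) u (fun s => Y s - a * s)
      (fun s => E s - E0)) as [p0 [M [e' [He' [Hp0 HM]]]]]; auto.
    + intros s. derive. ring.
    + intros s. derive. ring.
    + intros s _. rewrite <- Ha, <- HEm. ring.
    + intros eta Heta. destruct (Hysub eta Heta) as [M [S' HM]].
      exists (M + Rabs a), (Rmin S' 0). intros s Hs.
      assert (Hs1 : s <= S') by (eapply Rle_trans; [apply Hs|apply Rmin_l]).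
      assert (Hs2 : s <= 0) by (eapply Rle_trans; [apply Hs|apply Rmin_r]).
      specialize (HM s Hs1). specialize (Hy0 s).
      unfold Rminus. eapply Rle_trans; [apply Rabs_triang|].
      rewrite Rabs_Ropp, (Rabs_pos_eq (y s)) by lra.
      assert (1 <= exp (- eta * s)) by (rewrite <- exp_0; apply exp_le_exp; nra).
      assert (Rabs a * 1 <= Rabs a * exp (- eta * s))
        by (apply Rmult_le_compat_l; [apply Rabs_pos|assumption]).
      lra.
    + exists l, a, false. split; [assumption|].
      apply (Hfinal a M e'); auto. intros s Hs. specialize (HM s Hs).
      rewrite (Hp0 Hm), Rminus_0_r in HM. assumption.
Qed.

(** * Comparison and sliding *)

(** Shifting acts on the coefficient alone, because -(s + a) and -s are equivalent at -oo. *)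
Lemma has_asymptotics_shift (phi : R -> R) (l A : R) (b : bool) (a : R) :
  has_asymptotics phi l A b ->
  has_asymptotics (fun s => phi (s + a)) l (A * exp (l * a)) b.
Proof.
  intros Has e He.
  pose proof (exp_pos (l * a)) as Hx.
  (* Two of the three parts pay for the error at s + a, where the prefactor may double, the third
     for the change of the prefactor. *)
  set (e' := e / (3 * exp (l * a))).
  assert (He' : 0 < e') by (unfold e'; apply Rdiv_lt_0_compat; lra).
  assert (Hee : exp (l * a) * (3 * e') = e) by (unfold e'; field; lra).
  destruct (Has e' He') as [S HS].
  assert (Hpf : exists S', forall s, s <= S' -> prefactor b (s + a) <= 2 * prefactor b s /\
     Rabs A * Rabs (prefactor b (s + a) - prefactor b s) <= e' * prefactor b s).
  { destruct b; unfold prefactor.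
    - exists (Rmin (- Rabs a) (- (Rabs A * Rabs a / e'))). intros s Hs.
      pose proof (Rmin_l (- Rabs a) (- (Rabs A * Rabs a / e'))).
      pose proof (Rmin_r (- Rabs a) (- (Rabs A * Rabs a / e'))).
      pose proof (Rle_abs (- a)) as Ha. rewrite Rabs_Ropp in Ha. split; [lra|].
      replace (- (s + a) - - s) with (- a) by ring. rewrite Rabs_Ropp.
      replace (Rabs A * Rabs a) with (e' * (Rabs A * Rabs a / e')) by (field; lra).
      apply Rmult_le_compat_l; lra.
    - exists 0. intros s _. split; [lra|]. rewrite Rminus_diag, Rabs_R0. lra. }
  destruct Hpf as [S' HS'].
  exists (Rmin (S - a) S'). intros s Hs.
  pose proof (Rmin_l (S - a) S'). pose proof (Rmin_r (S - a) S').
  specialize (HS (s + a) ltac:(lra)). destruct (HS' s ltac:(lra)) as [H1 H2].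
  replace (exp (- l * s) * phi (s + a) - A * exp (l * a) * prefactor b s)
    with (exp (l * a) * ((exp (- l * (s + a)) * phi (s + a) - A * prefactor b (s + a))
                         + A * (prefactor b (s + a) - prefactor b s))).
  - rewrite Rabs_mult, (Rabs_pos_eq (exp _)) by lra.
    rewrite <- Hee, Rmult_assoc. apply Rmult_le_compat_l; [lra|].
    eapply Rle_trans; [apply Rabs_triang|]. rewrite (Rabs_mult A).
    assert (e' * prefactor b (s + a) <= e' * (2 * prefactor b s))
      by (apply Rmult_le_compat_l; lra).
    lra.
  - replace (- l * s) with (l * a + - l * (s + a)) by ring. rewrite exp_plus. ring.
Qed.

Definition eventually_le (phi psi : R -> R) : Prop :=
  exists S, forall s, s <= S -> phi s <= psi s.

Lemma le_of_weighted (l x y s : R) : exp (- l * s) * x <= exp (- l * s) * y -> x <= y.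
Proof. intros H. apply Rmult_le_reg_l with (exp (- l * s)); [apply exp_pos|exact H]. Qed.

Lemma eventually_le_of_coefficient phi psi l A A' b :
  has_asymptotics phi l A b -> has_asymptotics psi l A' b -> A < A' ->
  eventually_le phi psi.
Proof.
  intros H1 H2 HA.
  destruct (H1 ((A' - A) / 2) ltac:(lra)) as [S1 HS1].
  destruct (H2 ((A' - A) / 2) ltac:(lra)) as [S2 HS2].
  exists (Rmin S1 S2). intros s Hs.
  pose proof (Rmin_l S1 S2). pose proof (Rmin_r S1 S2).
  specialize (HS1 s ltac:(lra)). specialize (HS2 s ltac:(lra)).
  apply Rabs_le_between in HS1. apply Rabs_le_between in HS2.
  apply (le_of_weighted l _ _ s). lra.
Qed.

Lemma eventually_le_of_prefactor phi psi l A A' :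
  has_asymptotics phi l A false -> has_asymptotics psi l A' true -> 0 < A' ->
  eventually_le phi psi.
Proof.
  intros H1 H2 HA.
  destruct (H1 1 ltac:(lra)) as [S1 HS1].
  destruct (H2 (A' / 2) ltac:(lra)) as [S2 HS2].
  exists (Rmin (- (2 * (A + 1) / A')) (Rmin S1 S2)). intros s Hs.
  pose proof (Rmin_l (- (2 * (A + 1) / A')) (Rmin S1 S2)).
  pose proof (Rmin_r (- (2 * (A + 1) / A')) (Rmin S1 S2)).
  pose proof (Rmin_l S1 S2). pose proof (Rmin_r S1 S2).
  specialize (HS1 s ltac:(lra)). specialize (HS2 s ltac:(lra)).
  apply Rabs_le_between in HS1. apply Rabs_le_between in HS2.
  unfold prefactor in *. apply (le_of_weighted l _ _ s).
  assert (Hs' : A' / 2 * (2 * (A + 1) / A') <= A' / 2 * - s) by (apply Rmult_le_compat_l; lra).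
  replace (A' / 2 * (2 * (A + 1) / A')) with (A + 1) in Hs' by (field; lra).
  lra.
Qed.

(** Half of the rate gap absorbs a possible factor -s through 1 - s <= (1 + 1/eta) e^{-eta s}; the
    other half makes the quotient vanish. *)
Lemma eventually_le_of_rate phi psi l l' A A' b b' :
  has_asymptotics phi l A b -> has_asymptotics psi l' A' b' -> 0 < A -> 0 < A' -> l' < l ->
  eventually_le phi psi.
Proof.
  intros H1 H2 HA HA' Hl.
  destruct (H1 1 ltac:(lra)) as [S1 HS1].
  destruct (H2 (A' / 2) ltac:(lra)) as [S2 HS2].
  set (eta := (l - l') / 2).
  assert (Heta : 0 < eta) by (unfold eta; lra).
  destruct (exp_vanishes_at_minus_infinity eta ((A + 1) * (1 + / eta)) (A' / 2))
    as [S3 HS3]; [assumption|lra|].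
  exists (Rmin (Rmin (- 1) S3) (Rmin S1 S2)). intros s Hs.
  pose proof (Rmin_l (Rmin (- 1) S3) (Rmin S1 S2)).
  pose proof (Rmin_r (Rmin (- 1) S3) (Rmin S1 S2)).
  pose proof (Rmin_l (- 1) S3). pose proof (Rmin_r (- 1) S3).
  pose proof (Rmin_l S1 S2). pose proof (Rmin_r S1 S2).
  specialize (HS1 s ltac:(lra)). specialize (HS2 s ltac:(lra)). specialize (HS3 s ltac:(lra)).
  apply Rabs_le_between in HS1. apply Rabs_le_between in HS2.
  assert (Hp : prefactor b s <= 1 - s) by (destruct b; unfold prefactor; lra).
  assert (Hp' : 1 <= prefactor b' s) by (destruct b'; unfold prefactor; lra).
  assert (Hs1 : - s <= / eta * exp (- eta * s)).
  { apply Rmult_le_reg_l with eta; [assumption|].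
    rewrite <- Rmult_assoc, Rinv_r, Rmult_1_l by lra.
    pose proof (exp_ineq1_le (- eta * s)). lra. }
  assert (Hs2 : 1 <= exp (- eta * s)) by (rewrite <- exp_0; apply exp_le_exp; nra).
  apply (le_of_weighted l' _ _ s).
  apply Rle_trans with (A' / 2).
  - replace (exp (- l' * s)) with (exp (eta * s) * exp (eta * s) * exp (- l * s)).
    + apply Rle_trans with ((A + 1) * (1 + / eta) * exp (eta * s)); [|assumption].
      assert (Hq : exp (- l * s) * phi s <= (A + 1) * ((1 + / eta) * exp (- eta * s))).
      { apply Rle_trans with ((A + 1) * prefactor b s); [lra|].
        apply Rmult_le_compat_l; lra. }
      pose proof (exp_pos (eta * s)) as HE.
      assert (Hinv : exp (eta * s) * exp (- eta * s) = 1)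
        by (rewrite <- exp_plus, <- exp_0; f_equal; ring).
      replace ((A + 1) * (1 + / eta) * exp (eta * s)) with
        (exp (eta * s) * exp (eta * s) * ((A + 1) * ((1 + / eta) * exp (- eta * s)))).
      * rewrite (Rmult_assoc _ (exp (- l * s))). apply Rmult_le_compat_l; [nra|assumption].
      * transitivity ((A + 1) * (1 + / eta) * exp (eta * s) * (exp (eta * s) * exp (- eta * s)));
          [ring|rewrite Hinv; ring].
    + rewrite <- !exp_plus. f_equal. unfold eta. field.
  - assert (A' / 2 * 1 <= A' / 2 * prefactor b' s) by (apply Rmult_le_compat_l; lra). lra.
Qed.

(** * Order between shifted profiles on the whole line *)

Lemma wave_shift g kappa tau c mu phi d1 d2 a :
  wave g kappa tau c mu phi d1 d2 ->
  wave g kappa tau c mu (fun s => phi (s + a)) (fun s => d1 (s + a)) (fun s => d2 (s + a)).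
Proof.
  intros [Hd1 Hd2 Heq Hpos Hlt Hnn Hle Hleft Hright]. constructor; auto.
  - intros s. derive. ring.
  - intros s. derive. ring.
  - intros s. specialize (Heq (s + a)). replace (s - tau + a) with (s + a - tau) by ring. exact Heq.
  - intros e He. destruct (Hleft e He) as [A HA]. exists (A - a). intros s Hs. apply HA. lra.
  - intros e He. destruct (Hright e He) as [A HA]. exists (A - a). intros s Hs. apply HA. lra.
Qed.

Lemma wave_lipschitz g kappa tau c mu phi d1 d2 :
  wave g kappa tau c mu phi d1 d2 -> 0 < mu ->
  forall s t, s <= t -> phi t <= phi s + mu * kappa * (t - s).
Proof.
  intros Hw Hmu s t Hst.
  pose proof (wave_deriv _ _ _ _ _ _ _ _ Hw).
  assert (mu * kappa * s - phi s <= mu * kappa * t - phi t); [|lra].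
  apply (le_of_deriv_nonneg (fun s => mu * kappa * s - phi s) (fun s => mu * kappa - d1 s));
    [assumption| |].
  - intros x _. derive. ring.
  - intros x _. pose proof (wave_deriv_le _ _ _ _ _ _ _ _ Hw x).
    pose proof (wave_lt _ _ _ _ _ _ _ _ Hw x).
    assert (mu * phi x <= mu * kappa) by (apply Rmult_le_compat_l; lra). lra.
Qed.

Lemma wave_le_of_le_shifts g kappa tau c mu psi e1 e2 :
  wave g kappa tau c mu psi e1 e2 -> 0 < mu ->
  forall x s a0, (forall a, a0 < a -> x <= psi (s + a)) -> x <= psi (s + a0).
Proof.
  intros Hw Hmu x s a0 Hx. apply Rle_plus_epsilon. intros e He.
  assert (Hkap : 0 < kappa).
  { pose proof (wave_lt _ _ _ _ _ _ _ _ Hw 0). pose proof (wave_pos _ _ _ _ _ _ _ _ Hw 0). lra. }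
  assert (Hmk : 0 < mu * kappa) by (apply Rmult_lt_0_compat; lra).
  assert (Hd : 0 < e / (mu * kappa)) by (apply Rdiv_lt_0_compat; lra).
  pose proof (wave_lipschitz _ _ _ _ _ _ _ _ Hw Hmu (s + a0)
                (s + (a0 + e / (mu * kappa))) ltac:(lra)) as HL.
  replace (mu * kappa * (s + (a0 + e / (mu * kappa)) - (s + a0))) with e in HL by (field; lra).
  specialize (Hx (a0 + e / (mu * kappa)) ltac:(lra)). lra.
Qed.

(** Differentiability of [w1] is only given at x, so instead of a Taylor expansion the bound w1(s)
    <= (l / 2)(s - x) on a right neighbourhood is integrated. *)
Lemma not_minimum_of_deriv2_neg (w w1 : R -> R) (x l : R) :
  (forall s, is_derive w s (w1 s)) -> is_derive w1 x l -> w1 x = 0 -> l < 0 ->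
  exists y, x < y /\ w y < w x.
Proof.
  intros Hw Hw1 H0 Hl. apply is_derive_Reals in Hw1.
  destruct (Hw1 (- l / 2) ltac:(lra)) as [d Hd].
  pose proof (cond_pos d) as Hdp.
  exists (x + d / 2). split; [lra|].
  assert (w (x + d / 2) - w x <= l / 4 * (d / 2 * (d / 2))).
  { assert (l / 4 * ((x - x) * (x - x)) - w x <= l / 4 * ((x + d / 2 - x) * (x + d / 2 - x)) - w (x + d / 2)).
    { apply (le_of_deriv_nonneg (fun s => l / 4 * ((s - x) * (s - x)) - w s)
         (fun s => l / 2 * (s - x) - w1 s)); [lra| |].
      - intros s _. derive. field.
      - intros s Hs. destruct (Req_dec s x) as [-> | Hne]; [rewrite H0; lra|].
        specialize (Hd (s - x) ltac:(lra)).
        rewrite Rabs_pos_eq in Hd by lra. specialize (Hd ltac:(lra)).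
        replace (x + (s - x)) with s in Hd by ring. rewrite H0, Rminus_0_r in Hd.
        apply Rabs_def2 in Hd.
        replace (w1 s) with (w1 s / (s - x) * (s - x)) by (field; lra).
        rewrite <- Rmult_minus_distr_r. apply Rmult_le_pos; lra. }
    replace (x + d / 2 - x) with (d / 2) in H by ring.
    rewrite Rminus_diag in H. lra. }
  assert (0 < d / 2 * (d / 2)) by (apply Rmult_lt_0_compat; lra).
  nra.
Qed.

(** A negative value of w = psi - phi would yield a negative minimum x > M of w on [M - tau, oo).
    There w' = 0, and w(x - tau) >= w(x) with the contraction bounds g(psi(x - tau)) - g(phi(x -
    tau)) below by q w(x). The equation then gives w''(x) <= (1 - q) w(x) < 0, impossible at a
    minimum. *)
Lemma wave_le_at_plus_infinity g kappa tau c mu phi d1 d2 psi e1 e2 q r M :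
  wave g kappa tau c mu phi d1 d2 -> wave g kappa tau c mu psi e1 e2 -> 0 < tau ->
  (forall x y, 0 <= x -> x <= y -> g x <= g y) ->
  0 <= q < 1 -> (forall x y, kappa - r < x -> x <= y -> y < kappa -> g y - g x <= q * (y - x)) ->
  (forall s, M - tau <= s -> kappa - r < phi s /\ kappa - r < psi s) ->
  (forall s, M - tau <= s <= M -> phi s <= psi s) ->
  forall s, M <= s -> phi s <= psi s.
Proof.
  intros Hp Hq Htau Hgm Hq01 Hlip Hr HM s0 Hs0.
  apply Rnot_lt_le. intros Hlt.
  pose proof (wave_deriv _ _ _ _ _ _ _ _ Hp) as Hd1.
  pose proof (wave_deriv2 _ _ _ _ _ _ _ _ Hp) as Hd2.
  pose proof (wave_deriv _ _ _ _ _ _ _ _ Hq) as He1.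
  pose proof (wave_deriv2 _ _ _ _ _ _ _ _ Hq) as He2.
  set (w := fun s => psi s - phi s).
  assert (Hw : forall s, is_derive w s (e1 s - d1 s)) by (intros s; unfold w; derive; ring).
  assert (Hw1 : forall s, is_derive (fun s => e1 s - d1 s) s (e2 s - d2 s)) by (intros s; derive; ring).
  (* Beyond T the difference w exceeds w(s0), so a minimum over a compact interval is one over all
     of [M - tau, oo). *)
  destruct (wave_right _ _ _ _ _ _ _ _ Hq (phi s0 - psi s0) ltac:(lra)) as [T HT].
  destruct (continuity_ab_min w (M - tau) (Rmax s0 T)) as [x [Hmin Hx]].
  { pose proof (Rmax_l s0 T). lra. }
  { intros s _. apply continuity_pt_filterlim, (ex_derive_continuous w). eexists; apply Hw. }
  assert (Hx0 : w x <= w s0) by (apply Hmin; split; [lra|apply Rmax_l]).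
  assert (Hglob : forall s, M - tau <= s -> w x <= w s).
  { intros s Hs. destruct (Rle_dec s (Rmax s0 T)); [apply Hmin; lra|].
    pose proof (Rmax_r s0 T). specialize (HT s ltac:(lra)).
    pose proof (wave_lt _ _ _ _ _ _ _ _ Hp s). unfold w in *. lra. }
  assert (HxM : M < x).
  { apply Rnot_le_lt. intros Hle. specialize (HM x ltac:(lra)). unfold w in Hx0. lra. }
  assert (Hw10 : e1 x - d1 x = 0).
  { pose proof (proj1 (is_derive_Reals _ _ _) (Hw x)) as Hd.
    rewrite <- (derive_pt_eq_0 w x (e1 x - d1 x) (exist _ _ Hd) Hd).
    apply (deriv_minimum w M (x + 1)); try lra. intros s Hs1 Hs2. apply Hglob. lra. }
  destruct (not_minimum_of_deriv2_neg w (fun s => e1 s - d1 s) x (e2 x - d2 x))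
    as [y [Hy1 Hy2]]; auto.
  - pose proof (wave_eq _ _ _ _ _ _ _ _ Hp x) as E1.
    pose proof (wave_eq _ _ _ _ _ _ _ _ Hq x) as E2.
    assert (Hbr : q * w x <= g (psi (x - tau)) - g (phi (x - tau))).
    { destruct (Rle_dec (phi (x - tau)) (psi (x - tau))) as [Hle | Hle].
      - pose proof (Hgm _ _ (Rlt_le _ _ (wave_pos _ _ _ _ _ _ _ _ Hp (x - tau))) Hle).
        assert (w x < 0) by (unfold w in *; lra). nra.
      - destruct (Hr (x - tau) ltac:(lra)) as [Hr1 Hr2].
        specialize (Hlip (psi (x - tau)) (phi (x - tau)) Hr2 ltac:(lra)
                      (wave_lt _ _ _ _ _ _ _ _ Hp _)).
        specialize (Hglob (x - tau) ltac:(lra)).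
        assert (q * w x <= q * w (x - tau)) by (apply Rmult_le_compat_l; lra).
        unfold w in *. lra. }
    assert (Hc : c * e1 x = c * d1 x) by (replace (e1 x) with (d1 x) by lra; ring).
    assert (Hwx : w x < 0) by (unfold w in *; lra).
    assert (e2 x - d2 x <= (1 - q) * w x) by (unfold w in *; lra). nra.
  - specialize (Hglob y ltac:(lra)). lra.
Qed.

(** Let b be the infimum of the shifts above a0 that dominate phi, and suppose b > a0. If psi(. + b)
    touches phi, the two coincide, which contradicts domination near -oo by a smaller shift.
    Otherwise the gap is positive and b can be lowered: a' covers the far left, compactness the
    middle, the contraction near kappa the right. *)
Lemma wave_sliding g kappa tau c mu phi d1 d2 psi e1 e2 q r a0 :
  wave g kappa tau c mu phi d1 d2 -> wave g kappa tau c mu psi e1 e2 ->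
  0 < tau -> 0 < mu -> mu * mu - c * mu - 1 = 0 ->
  (forall x y, 0 <= x -> x <= y -> g x <= g y) ->
  0 <= q < 1 -> 0 < r ->
  (forall x y, kappa - r < x -> x <= y -> y < kappa -> g y - g x <= q * (y - x)) ->
  (forall a, a0 < a -> eventually_le phi (fun s => psi (s + a))) ->
  forall a, a0 < a -> forall s, phi s <= psi (s + a).
Proof.
  intros Hp Hq Htau Hmu Hroot Hgm Hq01 Hr Hlip Hev.
  pose proof (wave_monotone _ _ _ _ _ _ _ _ Hp) as Hpm.
  pose proof (wave_monotone _ _ _ _ _ _ _ _ Hq) as Hqm.
  pose proof (wave_lipschitz _ _ _ _ _ _ _ _ Hq Hmu) as HqL.
  assert (Hkap : 0 < kappa).
  { pose proof (wave_lt _ _ _ _ _ _ _ _ Hp 0). pose proof (wave_pos _ _ _ _ _ _ _ _ Hp 0). lra. }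
  assert (Hmk : 0 < mu * kappa) by (apply Rmult_lt_0_compat; lra).
  destruct (wave_right _ _ _ _ _ _ _ _ Hp r Hr) as [N1 HN1].
  destruct (wave_right _ _ _ _ _ _ _ _ Hq r Hr) as [N2 HN2].
  (* One M serves every shift a > a0, so the region near +oo stays fixed while the shift is
     lowered. *)
  set (M := Rmax N1 (N2 - a0) + tau).
  assert (HM1 : N1 <= M - tau) by (unfold M; pose proof (Rmax_l N1 (N2 - a0)); lra).
  assert (HM2 : N2 - a0 <= M - tau) by (unfold M; pose proof (Rmax_r N1 (N2 - a0)); lra).
  assert (Hext : forall a, a0 < a -> (forall s, s <= M -> phi s <= psi (s + a)) ->
             forall s, phi s <= psi (s + a)).
  { intros a Ha Hle s. destruct (Rle_dec s M) as [|Hn]; [auto|].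
    apply (wave_le_at_plus_infinity g kappa tau c mu phi d1 d2 (fun s => psi (s + a))
      (fun s => e1 (s + a)) (fun s => e2 (s + a)) q r M); auto.
    - apply wave_shift; assumption.
    - intros t Ht. split; [apply HN1; lra|apply HN2; lra].
    - intros t Ht. apply Hle; lra.
    - lra. }
  set (T := fun a => a0 < a /\ forall s, phi s <= psi (s + a)).
  assert (Hup : forall a a', T a -> a <= a' -> T a').
  { intros a a' [Ha HT] Haa. split; [lra|]. intros s.
    eapply Rle_trans; [apply HT|]. apply Hqm. lra. }
  assert (Hne : exists a, T a).
  { destruct (Hev (a0 + 1) ltac:(lra)) as [L HL].
    pose proof (wave_lt _ _ _ _ _ _ _ _ Hp M).
    destruct (wave_right _ _ _ _ _ _ _ _ Hq (kappa - phi M) ltac:(lra)) as [A HA].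
    set (a := Rmax (a0 + 1) (A - L)).
    assert (Ha1 : a0 + 1 <= a) by apply Rmax_l.
    assert (Ha2 : A - L <= a) by apply Rmax_r.
    exists a. split; [lra|]. apply Hext; [lra|]. intros s Hs.
    destruct (Rle_dec s L) as [HsL | HsL].
    - eapply Rle_trans; [apply HL; assumption|]. apply Hqm. lra.
    - specialize (HA (s + a) ltac:(lra)). specialize (Hpm s M Hs). lra. }
  destruct (completeness (fun v => T (- v))) as [nb [Hub Hlub]].
  { exists (- a0). intros v [Hv _]. lra. }
  { destruct Hne as [a Ha]. exists (- a). rewrite Ropp_involutive. assumption. }
  set (b := - nb).
  assert (Hinf : forall a, T a -> b <= a).
  { intros a Ha. assert (- a <= nb); [|unfold b; lra].
    apply Hub. rewrite Ropp_involutive. assumption. }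
  assert (Hab : forall a, b < a -> T a).
  { intros a Ha. apply NNPP. intros Hn.
    assert (nb <= - a); [|unfold b in Ha; lra].
    apply Hlub. intros v Hv. apply Rnot_lt_le. intros Hlt.
    apply Hn. apply (Hup (- v)); [assumption|lra]. }
  destruct (Rle_dec b a0) as [Hb | Hb].
  { intros a Ha. apply Hab. lra. }
  exfalso.
  assert (HTb : forall s, phi s <= psi (s + b)).
  { intros s. apply (wave_le_of_le_shifts _ _ _ _ _ _ _ _ Hq Hmu).
    intros a Ha. apply Hab; assumption. }
  set (a' := (a0 + b) / 2).
  assert (Ha' : a0 < a' < b) by (unfold a'; lra).
  destruct (Hev a' ltac:(lra)) as [L0 HL0].
  set (L := Rmin L0 M).
  assert (HL : forall s, s <= L -> phi s <= psi (s + a')).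
  { intros s Hs. apply HL0. eapply Rle_trans; [apply Hs|apply Rmin_l]. }
  pose proof (wave_shift _ _ _ _ _ _ _ _ b Hq) as Hqb.
  pose proof (wave_deriv _ _ _ _ _ _ _ _ Hp) as Hd1.
  pose proof (wave_deriv2 _ _ _ _ _ _ _ _ Hp) as Hd2.
  pose proof (wave_deriv _ _ _ _ _ _ _ _ Hqb) as He1.
  pose proof (wave_deriv2 _ _ _ _ _ _ _ _ Hqb) as He2.
  cbv beta in He1, He2.
  set (w := fun s => psi (s + b) - phi s).
  assert (Hw : forall s, is_derive w s (e1 (s + b) - d1 s)).
  { intros s. apply (is_derive_minus (fun s => psi (s + b)) phi); auto. }
  destruct (classic (exists s0, w s0 = 0)) as [[s0 Hs0] | Hpos].
  - assert (Hz : forall s, w s = 0).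
    { apply (supersolution_eq_zero c mu w (fun s => e1 (s + b) - d1 s)
               (fun s => e2 (s + b) - d2 s) s0); auto.
      - intros s. apply (is_derive_minus (fun s => e1 (s + b)) d1); auto.
      - intros s. unfold w. specialize (HTb s). lra.
      - intros s. pose proof (wave_eq _ _ _ _ _ _ _ _ Hp s).
        pose proof (wave_eq _ _ _ _ _ _ _ _ Hqb s) as H1. cbv beta in H1.
        pose proof (Hgm _ _ (Rlt_le _ _ (wave_pos _ _ _ _ _ _ _ _ Hp (s - tau))) (HTb (s - tau))).
        unfold w. lra. }
    (* Equality at shift b and domination by a' < b, used repeatedly, carry the positive value psi(L
       + b) to arguments tending to -oo. *)
    assert (Hper : forall n : nat, psi (L + b) <= psi (L + b - INR n * (b - a'))).
    { induction n as [|n IH].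
      - simpl. right. f_equal. ring.
      - rewrite S_INR. eapply Rle_trans; [apply IH|].
        set (t := L - INR n * (b - a')).
        assert (Ht : t <= L).
        { unfold t. pose proof (pos_INR n).
          assert (0 <= INR n * (b - a')) by (apply Rmult_le_pos; lra). lra. }
        specialize (HL t Ht). specialize (Hz t). unfold w in Hz.
        replace (L + b - INR n * (b - a')) with (t + b) by (unfold t; ring).
        replace (L + b - (INR n + 1) * (b - a')) with (t + a') by (unfold t; ring). lra. }
    destruct (wave_left _ _ _ _ _ _ _ _ Hq (psi (L + b)) (wave_pos _ _ _ _ _ _ _ _ Hq _)) as [A HA].
    destruct (INR_unbounded ((L + b - A) / (b - a'))) as [n Hn].
    specialize (Hper n). specialize (HA (L + b - INR n * (b - a'))).
    assert (L + b - INR n * (b - a') <= A).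
    { assert (L + b - A = (L + b - A) / (b - a') * (b - a')) by (field; lra). nra. }
    specialize (HA H). lra.
  - assert (Hwpos : forall s, 0 < w s).
    { intros s. destruct (HTb s) as [Hlt | Heq]; [unfold w; lra|].
      exfalso. apply Hpos. exists s. unfold w. lra. }
    destruct (continuity_ab_min w L M) as [x [Hmin _]].
    { apply Rmin_r. }
    { intros s _. apply continuity_pt_filterlim, (ex_derive_continuous w). eexists; apply Hw. }
    set (e := Rmin (b - a') (w x / (mu * kappa))).
    assert (He : 0 < e).
    { apply Rmin_glb_lt; [lra|]. apply Rdiv_lt_0_compat; [apply Hwpos|assumption]. }
    assert (He1' : e <= b - a') by apply Rmin_l.
    assert (He2' : mu * kappa * e <= w x).
    { replace (w x) with (mu * kappa * (w x / (mu * kappa))) by (field; lra).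
      apply Rmult_le_compat_l; [lra|apply Rmin_r]. }
    assert (HT : T (b - e)).
    { split; [lra|]. apply Hext; [lra|]. intros s Hs.
      destruct (Rle_dec s L) as [HsL | HsL].
      - eapply Rle_trans; [apply HL; assumption|]. apply Hqm. lra.
      - specialize (Hmin s ltac:(lra)).
        specialize (HqL (s + (b - e)) (s + b) ltac:(lra)).
        replace (s + b - (s + (b - e))) with e in HqL by ring.
        unfold w in *. lra. }
    specialize (Hinf _ HT). lra.
Qed.

(** * Constants drawn from (H), and the conclusion *)

Lemma linear_at_zero_of_right_deriv (g : R -> R) (g0 : R) :
  g 0 = 0 -> right_deriv_at g 0 g0 -> linear_at_zero g g0.
Proof.
  intros H0 Hd eta Heta. destruct (Hd eta Heta) as [d [Hd0 Hd']].
  exists d. split; [assumption|]. intros u Hu. specialize (Hd' u Hu).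
  rewrite Rplus_0_l, H0, Rminus_0_r in Hd'.
  replace (g u - g0 * u) with ((g u / u - g0) * u) by (field; lra).
  rewrite Rabs_mult, (Rabs_pos_eq u) by lra. apply Rmult_le_compat_r; lra.
Qed.

(** Continuity of g' at kappa keeps g' below the midpoint (1 + gk) / 2 < 1 nearby; the maximum with
    0 gives q the sign that the comparison near +oo uses. *)
Lemma contraction_near_fixed_point (g dg : R -> R) (kappa gk eps : R) :
  derivable_pt_lim g kappa gk -> gk < 1 -> 0 < eps ->
  (forall x, Rabs (x - kappa) < eps -> derivable_pt_lim g x (dg x) /\ continuity_pt dg x) ->
  exists q r, 0 <= q < 1 /\ 0 < r /\
    forall x y, kappa - r < x -> x <= y -> y < kappa -> g y - g x <= q * (y - x).
Proof.
  intros Hgk Hlt Heps Hdg.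
  destruct (Hdg kappa) as [Hk Hc]; [rewrite Rminus_diag, Rabs_R0; assumption|].
  assert (Hkk : dg kappa = gk) by (eapply uniqueness_limite; eauto).
  destruct (Hc ((1 - gk) / 2) ltac:(lra)) as [d [Hd Hcd]].
  exists (Rmax 0 ((1 + gk) / 2)), (Rmin d eps).
  pose proof (Rmin_l d eps) as Hr1. pose proof (Rmin_r d eps) as Hr2.
  split; [split; [apply Rmax_l|apply Rmax_lub_lt; lra]|].
  split; [apply Rmin_glb_lt; assumption|].
  intros x y Hx Hxy Hy.
  destruct (mvt_deriv g dg x y Hxy) as [z [Hz He]].
  { intros z Hz. apply is_derive_Reals. apply Hdg. apply Rabs_def1; lra. }
  rewrite He. apply Rmult_le_compat_r; [lra|].
  apply Rle_trans with ((1 + gk) / 2); [|apply Rmax_r].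
  specialize (Hcd z). simpl in Hcd. unfold Rdist in Hcd. rewrite Hkk in Hcd.
  assert (Hzc : Rabs (dg z - gk) < (1 - gk) / 2).
  { apply Hcd. split; [split; [exact I|lra]|]. apply Rabs_def1; lra. }
  apply Rabs_def2 in Hzc. lra.
Qed.

Lemma characteristic_root (c : R) : exists mu, 0 < mu /\ mu * mu - c * mu - 1 = 0.
Proof.
  set (d := sqrt (c * c + 4)).
  assert (Hcc : 0 <= c * c) by apply Rle_0_sqr.
  assert (Hd : d * d = c * c + 4) by (apply sqrt_sqrt; lra).
  assert (Hd0 : 0 <= d) by apply sqrt_pos.
  exists ((c + d) / 2). split; nra.
Qed.

Lemma wave_not_below_all_shifts g kappa tau c mu psi e1 e2 (x : R) :
  wave g kappa tau c mu psi e1 e2 -> 0 < x -> (forall a, x <= psi (0 + a)) -> False.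
Proof.
  intros Hw Hx Ha. destruct (wave_left _ _ _ _ _ _ _ _ Hw x Hx) as [A HA].
  specialize (HA A (Rle_refl A)). specialize (Ha A). rewrite Rplus_0_l in Ha. lra.
Qed.

Theorem theorem2 :
  forall (h : R) (g : R -> R) (kappa : R),
    0 < h -> HypH g kappa ->
    forall (c : R) (phi psi : R -> R),
      0 < c ->
      front_profile g kappa h c phi ->
      front_profile g kappa h c psi ->
      exists s0 : R, forall s : R, phi s = psi (s + s0).
Proof.
  intros h g kappa Hh HH c phi psi Hc Hphi Hpsi.
  destruct (characteristic_root c) as [mu [Hmu Hroot]].
  destruct (wave_of_front g kappa h c mu phi HH Hmu Hroot Hphi) as [d1 [d2 Hp]].
  destruct (wave_of_front g kappa h c mu psi HH Hmu Hroot Hpsi) as [e1 [e2 Hq]].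
  destruct HH as [_ [_ [Hinc [Hkap [Hfix [[g0 [Hg0 [Hg01 [C [theta [delta
    [HC [Hth [Hdelta Hholder]]]]]]]]] [[gk [Hgk Hgk1]] [eps [Heps [dg Hdg]]]]]]]]]].
  assert (Htau : 0 < c * h) by (apply Rmult_lt_0_compat; assumption).
  set (tau := c * h) in *.
  assert (Hgm : forall x y, 0 <= x -> x <= y -> g x <= g y).
  { intros x y Hx [Hxy | ->]; [left; apply Hinc; auto|lra]. }
  assert (Hlin : linear_at_zero g g0).
  { apply linear_at_zero_of_right_deriv; [|assumption]. apply Hfix; [lra|auto]. }
  destruct (contraction_near_fixed_point g dg kappa gk eps Hgk Hgk1 Heps Hdg)
    as [q [r [Hq01 [Hr Hlip]]]].
  destruct (wave_asymptotics g kappa tau c mu phi d1 d2 g0 C theta delta)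
    as [l [A [b [Hl [HA Has]]]]]; auto.
  destruct (wave_asymptotics g kappa tau c mu psi e1 e2 g0 C theta delta)
    as [l' [A' [b' [Hl' [HA' Has']]]]]; auto.
  assert (Hslide : forall a0, (forall a, a0 < a -> eventually_le phi (fun s => psi (s + a))) ->
            forall a, a0 < a -> forall s, phi s <= psi (s + a)).
  { intros a0. apply (wave_sliding g kappa tau c mu phi d1 d2 psi e1 e2 q r); auto. }
  assert (Hslide' : forall a0, (forall a, a0 < a -> eventually_le psi (fun s => phi (s + a))) ->
            forall a, a0 < a -> forall s, psi s <= phi (s + a)).
  { intros a0. apply (wave_sliding g kappa tau c mu psi e1 e2 phi d1 d2 q r); auto. }
  (* Sliding would extend the domination by all shifts from -oo to the point 0, where psi(0 + a)
     becomes smaller than phi(0) for very negative a. *)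
  assert (Hno : (forall a, eventually_le phi (fun s => psi (s + a))) -> False).
  { intros Hall. apply (wave_not_below_all_shifts _ _ _ _ _ _ _ _ (phi 0) Hq).
    - apply (wave_pos _ _ _ _ _ _ _ _ Hp).
    - intros a. apply (Hslide (a - 1)); [auto|lra]. }
  assert (Hno' : (forall a, eventually_le psi (fun s => phi (s + a))) -> False).
  { intros Hall. apply (wave_not_below_all_shifts _ _ _ _ _ _ _ _ (psi 0) Hp).
    - apply (wave_pos _ _ _ _ _ _ _ _ Hq).
    - intros a. apply (Hslide' (a - 1)); [auto|lra]. }
  assert (Hsh := fun a => has_asymptotics_shift phi l A b a Has).
  assert (Hsh' := fun a => has_asymptotics_shift psi l' A' b' a Has').
  assert (Hpos : forall x a, 0 < x -> 0 < x * exp (l * a)).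
  { intros x a Hx. apply Rmult_lt_0_compat; [assumption|apply exp_pos]. }
  destruct (Rtotal_order l l') as [Hlt | [<- | Hlt]].
  { exfalso. apply Hno'. intros a.
    apply (eventually_le_of_rate _ _ l' l A' (A * exp (l * a)) b' b); auto. }
  2: { exfalso. apply Hno. intros a.
    apply (eventually_le_of_rate _ _ l l' A (A' * exp (l' * a)) b b'); auto.
    apply Rmult_lt_0_compat; [assumption|apply exp_pos]. }
  destruct (Bool.bool_dec b b') as [<- | Hb].
  2: { exfalso. destruct b, b'; try congruence.
    - apply Hno'. intros a.
      apply (eventually_le_of_prefactor _ _ l A' (A * exp (l * a))); auto.
    - apply Hno. intros a.
      apply (eventually_le_of_prefactor _ _ l A (A' * exp (l * a))); auto. }
  (* The shift of psi whose leading coefficient equals that of phi; every larger shift has a larger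
     one. *)
  set (a0 := ln (A / A') / l).
  assert (HAA : 0 < A / A') by (apply Rdiv_lt_0_compat; assumption).
  assert (Ha0 : A' * exp (l * a0) = A).
  { unfold a0. replace (l * (ln (A / A') / l)) with (ln (A / A')) by (field; lra).
    rewrite exp_ln by assumption. field; lra. }
  assert (Ha0' : A * exp (l * - a0) = A').
  { rewrite <- Ha0 at 1. rewrite Rmult_assoc, <- exp_plus.
    replace (l * a0 + l * - a0) with 0 by ring. rewrite exp_0. ring. }
  assert (H1 : forall a, a0 < a -> forall s, phi s <= psi (s + a)).
  { apply Hslide. intros a Ha.
    apply (eventually_le_of_coefficient _ _ l A (A' * exp (l * a)) b Has (Hsh' a)).
    rewrite <- Ha0 at 1. apply Rmult_lt_compat_l; [assumption|].
    apply exp_increasing, Rmult_lt_compat_l; assumption. }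
  assert (H2 : forall a, - a0 < a -> forall s, psi s <= phi (s + a)).
  { apply Hslide'. intros a Ha.
    apply (eventually_le_of_coefficient _ _ l A' (A * exp (l * a)) b Has' (Hsh a)).
    rewrite <- Ha0' at 1. apply Rmult_lt_compat_l; [assumption|].
    apply exp_increasing, Rmult_lt_compat_l; assumption. }
  (* Domination is known for shifts strictly beyond a0 and -a0, and passes to these limits by
     continuity. *)
  exists a0. intros s. apply Rle_antisym.
  - apply (wave_le_of_le_shifts _ _ _ _ _ _ _ _ Hq Hmu). auto.
  - replace s with (s + a0 + - a0) at 2 by ring.
    apply (wave_le_of_le_shifts _ _ _ _ _ _ _ _ Hp Hmu). auto.
Qed.
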